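(* Let $f(z)=z+\sum_{n\ge 2}a_nz^n\in\mathcal{BT}_{\mathfrak{B}}$ and let $\gamma_n=\gamma_n(f)$ be its logarithmic coefficients. Then $$|\gamma_n|\le \frac{1}{4(n+1)}\qquad\text{for } n=1,2,3,4,$$ that is, $|\gamma_1|\le 1/8$, $|\gamma_2|\le 1/12$, $|\gamma_3|\le 1/16$, $|\gamma_4|\le 1/20$. For each $n\in\{1,2,3,4\}$ the bound is attained by the function $f_n(z)=\int_0^z\sqrt{1+\tanh(t^n)}\,dt$.
   Context: $\mathbb{D}=\{z\in\mathbb{C}:|z|<1\}$. $\mathcal{S}$ is the class of univalent analytic functions $f$ on $\mathbb{D}$ normalized by $f(0)=0$, $f'(0)=1$, i.e. $f(z)=z+\sum_{n\ge2}a_nz^n$. For analytic $g,h$ on $\mathbb{D}$, $g\prec h$ (subordination) means there is an analytic $\omega:\mathbb{D}\to\mathbb{D}$ with $\omega(0)=0$ and $g=h\circ\omega$. Let $\mathfrak{B}(z)=\sqrt{1+\tanh z}$ (principal branch, $\mathfrak{B}(0)=1$). The class $\mathcal{BT}_{\mathfrak{B}}$ is $\{f\in\mathcal{S}: f'(z)\prec \mathfrak{B}(z)\}$. The logarithmic coefficients $\gamma_n(f)$ are defined by $\log\frac{f(z)}{z}=2\sum_{n\ge1}\gamma_n(f)z^n$ (with $\log 1=0$); explicitly $\gamma_1=\tfrac12 a_2$, $\gamma_2=\tfrac12(a_3-\tfrac12a_2^2)$, $\gamma_3=\tfrac12(a_4-a_2a_3+\tfrac13a_2^3)$, $\gamma_4=\tfrac12(a_5-a_2a_4+a_2^2a_3-\tfrac12a_3^2-\tfrac14a_2^4)$.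 *)

(* Defs.v *)
(* mathcomp-analysis over an arbitrary realType R, with the
   complex numbers C = R[i] from mathcomp-real-closed, viewed as a
   numFieldType (hence a normed module over itself, so that [derivable] and
   [derive1] below are genuine complex derivatives). *)
From HB Require Import structures.
From mathcomp Require Import all_boot all_order all_algebra.
From mathcomp Require Import all_classical all_reals all_analysis.
From mathcomp Require Import complex.
Import ComplexField.
Import Order.TTheory GRing.Theory Num.Theory.
Import numFieldNormedType.Exports.
Set Implicit Arguments.
Unset Strict Implicit.
Unset Printing Implicit Defensive.
Local Open Scope ring_scope.
Local Open Scope complex_scope.
Local Open Scope classical_set_scope.

Definition CC (R : realType) : numFieldType := R[i].

Section Defs.
Variable R : realType.
Local Notation C := (CC R).

Definition expC (z : C) : C :=
  (expR (complex.Re z) * cos (complex.Im z)) +i*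
  (expR (complex.Re z) * sin (complex.Im z)).

Definition tanhC (z : C) : C := (expC (2 * z) - 1) / (expC (2 * z) + 1).

(* Principal branch of the complex square root (argument in (-pi/2, pi/2]):
   sqrt(a+ib) = sqrt((|z|+a)/2) + i sgn(b) sqrt((|z|-a)/2), sgn(0) := +1. *)
Definition psqrtC (z : C) : C :=
  let a := complex.Re z in let b := complex.Im z in
  let m := Num.sqrt (a ^+ 2 + b ^+ 2) in
  (Num.sqrt ((m + a) / 2)) +i*
  (if b < 0 then - Num.sqrt ((m - a) / 2) else Num.sqrt ((m - a) / 2)).

Definition frakB (z : C) : C := psqrtC (1 + tanhC z).

Definition inD (z : C) : Prop := `|z| < 1.

Definition holo_D (f : C -> C) : Prop := forall z, inD z -> derivable f z 1.

Definition taylor_D (f : C -> C) (a : nat -> C) : Prop :=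
  forall z, inD z -> series (fun n => a n * z ^+ n) @ \oo --> f z.

Definition univalent_D (f : C -> C) : Prop :=
  forall z w, inD z -> inD w -> f z = f w -> z = w.

Definition subord (g h : C -> C) : Prop :=
  exists w : C -> C, holo_D w /\ (forall z, inD z -> inD (w z)) /\ w 0 = 0 /\
    forall z, inD z -> g z = h (w z).

Definition classS (f : C -> C) (a : nat -> C) : Prop :=
  holo_D f /\ taylor_D f a /\ a 0%N = 0 /\ a 1%N = 1 /\ univalent_D f.

Definition classBT (f : C -> C) (a : nat -> C) : Prop :=
  classS f a /\ subord (derive1 f) frakB.

Definition gamma1 (a : nat -> C) : C := (a 2%N) / 2.
Definition gamma2 (a : nat -> C) : C := (a 3%N - (a 2%N) ^+ 2 / 2) / 2.
Definition gamma3 (a : nat -> C) : C :=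
  (a 4%N - a 2%N * a 3%N + (a 2%N) ^+ 3 / 3) / 2.
Definition gamma4 (a : nat -> C) : C :=
  (a 5%N - a 2%N * a 4%N + (a 2%N) ^+ 2 * a 3%N - (a 3%N) ^+ 2 / 2
   - (a 2%N) ^+ 4 / 4) / 2.

Definition gamma (n : nat) (a : nat -> C) : C :=
  match n with
  | 1 => gamma1 a | 2 => gamma2 a | 3 => gamma3 a | 4 => gamma4 a
  | _ => 0 end.

End Defs.

(* Main.v *)
(* If f' = B o w with w a Schwarz function, then B' = B (2 - B^2) / 2 gives the
   equation w' g (2 - g^2) = 2 g' for g = f', from which gamma_n becomes
   1/(4(n+1)) times a polynomial F_n in the Taylor coefficients c_1, ..., c_4 of w.
   Since |w| <= 1, multiplication by w does not increase l^2 norms of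
   coefficients: sum_k |(w p)_k|^2 <= sum_k |p_k|^2 for every polynomial p.
   Taking p = 1 + p_1 z + p_2 z^2 + p_3 z^3 with the p_j suitable polynomials in
   the c_i makes F_n a coefficient of w p, and the inequality then gives
   |F_n| <= 1.

   Neither integrals nor power series of w are needed for this.  The function w is
   infinitely expandable at each point by the differential equation, and a
   function that has second order expansions satisfies the maximum principle
   (compare |h|^2 at z with its values at z + t, z - t, z + it, z - it).  The
   maximum principle applied to the averages of w p over rotations by roots of
   unity, divided by powers of z, yields the l^2 inequality, Cauchy's estimates
   and the convergence of Taylor series; the last of these provides the
   extremal functions, which are univalent because Re f' > 0. *)
Require Import Defs.
From HB Require Import structures.
From mathcomp Require Import all_boot all_order all_algebra.
From mathcomp Require Import all_classical all_reals all_analysis.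
From mathcomp Require Import complex.
From mathcomp Require Import cyclic separable cyclotomic ring lra.
Import ComplexField.
Import Order.TTheory GRing.Theory Num.Theory.
Import numFieldNormedType.Exports.
Set Implicit Arguments.
Unset Strict Implicit.
Unset Printing Implicit Defensive.
Local Open Scope ring_scope.
Local Open Scope classical_set_scope.

(** * Local estimates in the complex plane *)

(** Origin of the p_j: the l^2 inequality gives |F_n| <= 1 as soon as |p_1|^2 + |p_2|^2 + |p_3|^2 is
    at most the sum of |(w p)_k|^2 over 1 <= k < n. So p_j is sought of weight j in the c_i and
    controlled by the coefficients of w p already formed, starting with |p_1| <= |c_1|. Matching the
    monomials of F_n determines p up to the splitting of mixed ones (c_1 c_3 arises from p_1 c_3 and
    from p_3 c_1). What remains is the positivity of real binary quadratic forms, applied to real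
    and imaginary parts separately, with |c_1| <= 1 absorbing differences of degree. The obstacle is
    regularity: w is given only as complex differentiable. The power series of f makes f' the
    regular object, and w inherits from it by inverting B. *)

Section Modulus.
Variable R : realType.
Local Notation C := (CC R).
Implicit Types z w : C.

(** The norm of [CC R] takes its values in [CC R] itself; a modulus with values in [R] opens
    estimates to [lra] and [nra]. *)
Definition cabs z : R := complex.Re `|z|.
Definition toC (x : R) : C := (x%:C)%C.

Lemma cabsE z : `|z| = toC (cabs z).
Proof. by rewrite /toC /cabs normc_def. Qed.

Lemma cabs_sqr z : cabs z ^+ 2 = complex.Re z ^+ 2 + complex.Im z ^+ 2.
Proof. by rewrite /cabs normc_def /= sqr_sqrtr // addr_ge0 ?sqr_ge0. Qed.

Lemma cabs_ge0 z : 0 <= cabs z.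
Proof. by rewrite /cabs normc_def /= sqrtr_ge0. Qed.

Lemma toC_le (x y : R) : (toC x <= toC y) = (x <= y).
Proof. exact: lecR. Qed.

Lemma toC_lt (x y : R) : (toC x < toC y) = (x < y).
Proof. exact: ltcR. Qed.

Lemma toC_inj : injective toC.
Proof. by move=> x y []. Qed.

Lemma toCD (x y : R) : toC (x + y) = toC x + toC y.
Proof. exact: (rmorphD (real_complex R)). Qed.
Lemma toCM (x y : R) : toC (x * y) = toC x * toC y.
Proof. exact: (rmorphM (real_complex R)). Qed.
Lemma toCN (x : R) : toC (- x) = - toC x.
Proof. exact: (rmorphN (real_complex R)). Qed.
Lemma toCX (x : R) n : toC (x ^+ n) = toC x ^+ n.
Proof. exact: (rmorphXn (real_complex R)). Qed.
Lemma toCV (x : R) : toC (x^-1) = (toC x)^-1.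
Proof. exact: (fmorphV (real_complex R)). Qed.
Lemma toC_nat n : toC n%:R = n%:R.
Proof. exact: (rmorph_nat (real_complex R)). Qed.
Lemma toC0 : toC 0 = 0. Proof. by []. Qed.
Lemma toC1 : toC 1 = 1. Proof. by []. Qed.

Lemma cabsM z w : cabs (z * w) = cabs z * cabs w.
Proof. by apply: toC_inj; rewrite toCM -!cabsE normrM. Qed.

Lemma cabsD z w : cabs (z + w) <= cabs z + cabs w.
Proof. by rewrite -toC_le toCD -!cabsE ler_normD. Qed.

Lemma cabsN z : cabs (- z) = cabs z.
Proof. by rewrite /cabs normrN. Qed.

Lemma cabsB z w : cabs (z - w) <= cabs z + cabs w.
Proof. by rewrite -(cabsN w) cabsD. Qed.

Lemma cabs0 : cabs 0 = 0. Proof. by rewrite /cabs normr0. Qed.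
Lemma cabs1 : cabs 1 = 1. Proof. by rewrite /cabs normr1. Qed.

Lemma cabs_eq0 z : (cabs z == 0) = (z == 0).
Proof.
apply/eqP/eqP => [h|->]; last exact: cabs0.
by apply/normr0_eq0; rewrite cabsE h.
Qed.

Lemma cabs_gt0 z : (0 < cabs z) = (z != 0).
Proof. by rewrite lt_neqAle cabs_ge0 andbT eq_sym cabs_eq0. Qed.

Lemma cabsX z n : cabs (z ^+ n) = cabs z ^+ n.
Proof. by elim: n => [|n IH]; rewrite ?expr0 ?cabs1 // !exprS cabsM IH. Qed.

Lemma cabsV z : cabs z^-1 = (cabs z)^-1.
Proof. by apply: toC_inj; rewrite toCV -!cabsE normfV. Qed.

Lemma cabs_toC (x : R) : cabs (toC x) = `|x|.
Proof. by rewrite /cabs normc_def /= expr0n addr0 sqrtr_sqr. Qed.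

Lemma cabs_nat n : cabs n%:R = n%:R.
Proof. by rewrite -toC_nat cabs_toC ger0_norm. Qed.

Lemma cabs_dist z w : cabs z - cabs w <= cabs (z - w).
Proof. by rewrite lerBlDr -{1}(subrK w z) cabsD. Qed.

Lemma cabs_sum (I : Type) (r : seq I) (P : pred I) (F : I -> C) :
  cabs (\sum_(i <- r | P i) F i) <= \sum_(i <- r | P i) cabs (F i).
Proof.
elim/big_ind2: _ => [|x1 x2 y1 y2 h1 h2|//]; first by rewrite cabs0.
by apply: le_trans (cabsD _ _) _; exact: lerD.
Qed.

Lemma Re_add z w : complex.Re (z + w) = complex.Re z + complex.Re w.
Proof. by case: z => a b; case: w. Qed.
Lemma Im_add z w : complex.Im (z + w) = complex.Im z + complex.Im w.
Proof. by case: z => a b; case: w. Qed.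
Lemma Re_opp z : complex.Re (- z) = - complex.Re z.
Proof. by case: z. Qed.
Lemma Im_opp z : complex.Im (- z) = - complex.Im z.
Proof. by case: z. Qed.
Lemma Re_mul z w : complex.Re (z * w) =
  complex.Re z * complex.Re w - complex.Im z * complex.Im w.
Proof. by case: z => a b; case: w. Qed.
Lemma Im_mul z w : complex.Im (z * w) =
  complex.Re z * complex.Im w + complex.Im z * complex.Re w.
Proof. by case: z => a b; case: w => c d /=; rewrite [_ + b * c]addrC addrC. Qed.
Lemma Re_toC (x : R) : complex.Re (toC x) = x. Proof. by []. Qed.
Lemma Im_toC (x : R) : complex.Im (toC x) = 0. Proof. by []. Qed.
Lemma Cext z w : complex.Re z = complex.Re w -> complex.Im z = complex.Im w -> z = w.
Proof. by case: z => a b; case: w => c d /= -> ->. Qed.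

Definition ReImE := (Re_add, Im_add, Re_opp, Im_opp, Re_mul, Im_mul, Re_toC, Im_toC).

Lemma Re_le_cabs z : `|complex.Re z| <= cabs z.
Proof. by rewrite -toC_le -cabsE; exact: normc_ge_Re. Qed.

Lemma Im_le_cabs z : `|complex.Im z| <= cabs z.
Proof.
rewrite -(ler_pXn2r (n := 2)) ?nnegrE ?cabs_ge0 //.
by rewrite cabs_sqr real_normK ?num_real // lerDr sqr_ge0.
Qed.

Lemma cabs_le_ReIm z : cabs z <= `|complex.Re z| + `|complex.Im z|.
Proof.
rewrite -(ler_pXn2r (n := 2)) ?nnegrE ?cabs_ge0 ?addr_ge0 //.
rewrite cabs_sqr sqrrD !real_normK ?num_real //.
have : 0 <= `|complex.Re z| * `|complex.Im z| by rewrite mulr_ge0.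
by lra.
Qed.

Lemma inDE z : inD z <-> cabs z < 1.
Proof. by rewrite /inD cabsE -toC1 toC_lt. Qed.

End Modulus.

(** * Order estimates at 0 with explicit constants *)

Section BigO.
Variable R : realType.
Local Notation C := (CC R).
Implicit Types (phi psi : C -> C).

(** The point h = 0 is included, so for positive [k] the estimate also forces [phi 0 = 0]. *)
Definition bigO (k : nat) phi := exists K d : R,
  [/\ 0 < d, 0 <= K & forall h, cabs h < d -> cabs (phi h) <= K * cabs h ^+ k].

Lemma bigO_near k phi psi :
  (exists2 d : R, 0 < d & forall h, cabs h < d -> phi h = psi h) ->
  bigO k phi -> bigO k psi.
Proof.
move=> [d d0 e] [K [d' [d'0 K0 H]]]; exists K, (Num.min d d'); split => //.
  by rewrite lt_min d0.
by move=> h; rewrite lt_min => /andP[h1 h2]; rewrite -e // H.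
Qed.

Lemma bigO_ext k phi psi : phi =1 psi -> bigO k phi -> bigO k psi.
Proof. by move=> e; apply: bigO_near; exists 1. Qed.

Lemma bigOD k phi psi : bigO k phi -> bigO k psi -> bigO k (fun h => phi h + psi h).
Proof.
move=> [K1 [d1 [d10 K10 H1]]] [K2 [d2 [d20 K20 H2]]].
exists (K1 + K2), (Num.min d1 d2); split; rewrite ?lt_min ?d10 ?addr_ge0 //.
move=> h; rewrite lt_min => /andP[h1 h2]; rewrite mulrDl.
by apply: le_trans (cabsD _ _) _; rewrite lerD ?H1 ?H2.
Qed.

Lemma bigON k phi : bigO k phi -> bigO k (fun h => - phi h).
Proof. by move=> [K [d [d0 K0 H]]]; exists K, d; split=> // h hd; rewrite cabsN H. Qed.

Lemma bigOB k phi psi : bigO k phi -> bigO k psi -> bigO k (fun h => phi h - psi h).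
Proof. by move=> h1 /bigON; exact: bigOD. Qed.

Lemma bigOM k l phi psi :
  bigO k phi -> bigO l psi -> bigO (k + l) (fun h => phi h * psi h).
Proof.
move=> [K1 [d1 [d10 K10 H1]]] [K2 [d2 [d20 K20 H2]]].
exists (K1 * K2), (Num.min d1 d2); split; rewrite ?lt_min ?d10 ?mulr_ge0 //.
move=> h; rewrite lt_min => /andP[h1 h2]; rewrite exprD mulrACA cabsM.
by rewrite ler_pM ?cabs_ge0 ?H1 ?H2.
Qed.

Lemma bigO_cst (c : C) : bigO 0 (fun=> c).
Proof. by exists (cabs c), 1; split; rewrite ?cabs_ge0 // => h _; rewrite expr0 mulr1. Qed.

Lemma bigO_Xn k : bigO k (fun h => h ^+ k).
Proof. by exists 1, 1; split => // h _; rewrite mul1r cabsX. Qed.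

Lemma bigO_id : bigO 1 id.
Proof. exact: bigO_Xn 1. Qed.

Lemma bigO0 k : bigO k (fun=> 0).
Proof.
by exists 0, 1; split => // h _; rewrite cabs0 mul0r.
Qed.

Lemma bigO_le k l phi : (k <= l)%N -> bigO l phi -> bigO k phi.
Proof.
move=> kl [K [d [d0 K0 H]]]; exists K, (Num.min d 1); split => //.
  by rewrite lt_min d0 ltr01.
move=> h; rewrite lt_min => /andP[h1 h2]; apply: le_trans (H _ h1) _.
by rewrite ler_wpM2l // ler_wiXn2l ?cabs_ge0 // ltW.
Qed.

Lemma bigOZ k (c : C) phi : bigO k phi -> bigO k (fun h => c * phi h).
Proof. exact: bigOM (bigO_cst c). Qed.

Lemma bigO_comp k phi psi : bigO k phi -> bigO 1 psi -> bigO k (phi \o psi).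
Proof.
move=> [K1 [d1 [d10 K10 H1]]] [K2 [d2 [d20 K20 H2]]].
have K2' : 0 < K2 + 1 by rewrite ltr_wpDl.
exists (K1 * K2 ^+ k), (Num.min d2 (d1 / (K2 + 1))); split.
- by rewrite lt_min d20 divr_gt0.
- by rewrite mulr_ge0 ?exprn_ge0.
move=> h; rewrite lt_min => /andP[h1 h2] /=.
have e := H2 _ h1; rewrite expr1 in e.
have lt1 : cabs (psi h) < d1.
  apply: le_lt_trans e _; rewrite ltr_pdivlMr // in h2; apply: le_lt_trans h2.
  by rewrite mulrC ler_wpM2l ?cabs_ge0 // lerDl.
apply: le_trans (H1 _ lt1) _; rewrite -mulrA -exprMn ler_wpM2l //.
by rewrite lerXn2r ?nnegrE ?mulr_ge0 ?cabs_ge0.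
Qed.

Lemma bigO_small phi (e : R) : bigO 1 phi -> 0 < e ->
  exists2 d : R, 0 < d & forall h, cabs h < d -> cabs (phi h) < e.
Proof.
move=> [K [d [d0 K0 H]]] e0; have K1 : 0 < K + 1 by rewrite ltr_wpDl.
exists (Num.min d (e / (K + 1))); first by rewrite lt_min d0 divr_gt0.
move=> h; rewrite lt_min ltr_pdivlMr // => /andP[h1 h2].
apply: le_lt_trans (H _ h1) _; apply: le_lt_trans h2.
by rewrite expr1 mulrC ler_wpM2l ?cabs_ge0 // lerDl.
Qed.

Lemma bigO_inv (F : C -> C) z : F z != 0 -> bigO 1 (fun h => F (z + h) - F z) ->
  bigO 0 (fun h => (F (z + h))^-1) /\
  exists2 d : R, 0 < d & forall h, cabs h < d -> F (z + h) != 0.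
Proof.
move=> Fz0 H; have c0 : 0 < cabs (F z) / 2 by rewrite divr_gt0 ?cabs_gt0.
have [d d0 Hd] := bigO_small H c0.
have lo h : cabs h < d -> cabs (F z) / 2 <= cabs (F (z + h)).
  move=> /Hd; have := cabs_dist (F z) (F (z + h)); rewrite -(cabsN (F z - _)) opprB.
  by lra.
split; last first.
  by exists d => // h /lo hl; rewrite -cabs_gt0 (lt_le_trans c0).
exists (cabs (F z) / 2)^-1, d; split; rewrite ?invr_ge0 ?ltW // => h hd.
by rewrite expr0 mulr1 cabsV lef_pV2 ?posrE ?lo // (lt_le_trans c0) ?lo.
Qed.

End BigO.

(** * Derivatives with quadratic remainder *)

Section QDeriv.
Variable R : realType.
Local Notation C := (CC R).
Implicit Types (F G : C -> C) (z d e : C).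

(* Differentiability with a quadratic remainder: it makes the calculus rules
   algebraic, and every function below that is differentiable on the disc has it. *)
Definition qderiv F z d := bigO 2 (fun h => F (z + h) - F z - d * h).

Lemma qderiv_lip F z d : qderiv F z d -> bigO 1 (fun h => F (z + h) - F z).
Proof.
move=> H; have := bigOD (bigO_le (isT : (1 <= 2)%N) H) (bigOZ d (@bigO_id R)).
by apply: bigO_ext => h; rewrite subrK.
Qed.

Lemma qderiv_ext F G z d : F =1 G -> qderiv F z d -> qderiv G z d.
Proof. by move=> e; apply: bigO_ext => h; rewrite !e. Qed.

Lemma qderiv_cst c z : qderiv (fun=> c) z 0.
Proof. by apply: bigO_ext (bigO0 _ 2) => h; rewrite subrr mul0r subr0. Qed.

Lemma qderiv_id z : qderiv id z 1.
Proof. by apply: bigO_ext (bigO0 _ 2) => h; ring. Qed.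

Lemma qderivD F G z d e : qderiv F z d -> qderiv G z e ->
  qderiv (fun y => F y + G y) z (d + e).
Proof. by move=> hF hG; apply: bigO_ext (bigOD hF hG) => h; ring. Qed.

Lemma qderivN F z d : qderiv F z d -> qderiv (fun y => - F y) z (- d).
Proof. by move=> hF; apply: bigO_ext (bigON hF) => h; ring. Qed.

Lemma qderivB F G z d e : qderiv F z d -> qderiv G z e ->
  qderiv (fun y => F y - G y) z (d - e).
Proof. by move=> hF /qderivN; exact: qderivD. Qed.

Lemma qderivM F G z d e : qderiv F z d -> qderiv G z e ->
  qderiv (fun y => F y * G y) z (d * G z + F z * e).
Proof.
move=> hF hG.
apply: bigO_ext (bigOD (bigOM (qderiv_lip hF) (qderiv_lip hG))
  (bigOD (bigOZ (G z) hF) (bigOZ (F z) hG))) => h; ring.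
Qed.

Lemma qderivZ F z d c : qderiv F z d -> qderiv (fun y => c * F y) z (c * d).
Proof. by move=> hF; apply: bigO_ext (bigOZ c hF) => h; ring. Qed.

Lemma qderivX F z d n : qderiv F z d ->
  qderiv (fun y => F y ^+ n) z (n%:R * F z ^+ n.-1 * d).
Proof.
move=> hF; elim: n => [|n IH]; first by rewrite !mul0r; exact: qderiv_cst.
have := qderivM hF IH; rewrite (_ : _ + _ = n.+1%:R * F z ^+ n * d).
  by apply: qderiv_ext => y; rewrite exprS.
case: n {IH} => [|n]; first by rewrite !expr0; ring.
by rewrite /= exprS -[n.+2]addn1 natrD; ring.
Qed.

Lemma qderivV F z d : F z != 0 -> qderiv F z d ->
  qderiv (fun y => (F y)^-1) z (- d / F z ^+ 2).
Proof.
move=> Fz hF; have [hi [e e0 ne]] := bigO_inv Fz (qderiv_lip hF).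
have lip := qderiv_lip hF.
(* With D = F(z+h) - F(z), 1/F(z+h) = 1/F(z) - D/F(z)^2 + D^2/(F(z)^2 F(z+h)); the last term is
   O(h^2), and D differs from d h by O(h^2). *)
have := bigOD (bigOZ (F z ^- 2) (bigOM hi (bigOM lip lip)))
              (bigOZ (- F z ^- 2) hF).
apply: bigO_near; exists e => // h he; have nz := ne _ he; field.
by rewrite Fz nz.
Qed.

Lemma qderiv_comp F G z d e : qderiv F (G z) d -> qderiv G z e ->
  qderiv (F \o G) z (d * e).
Proof.
move=> hF hG.
have := bigOD (bigO_comp hF (qderiv_lip hG)) (bigOZ d hG).
by apply: bigO_ext => h /=; rewrite (addrCA (G z)) subrr addr0; ring.
Qed.

End QDeriv.

(** Needed over two fields: over C to return to genuine complex derivatives, over R to feed the real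
    mean value theorem along a segment. *)
Lemma is_derive_of_quadratic (K : numFieldType) (F : K -> K) (z D M d : K) :
  0 < d -> 0 <= M ->
  (forall h, `|h| < d -> `|F (z + h) - F z - D * h| <= M * `|h| ^+ 2) ->
  is_derive z (1 : K) F D.
Proof.
move=> d0 M0 H.
have cv : (fun h : K => h^-1 *: (F (h *: 1 + z) - F z)) @ 0^' --> D.
  apply/cvgrPdist_le => e e0.
  have M1 : 0 < M + 1 by rewrite ltr_wpDl.
  near=> h.
  have h0 : h != 0 by near: h; exact: nbhs_dnbhs_neq.
  have hd : `|h| < d by near: h; exact: dnbhs0_lt.
  have he : `|h| < e / (M + 1) by near: h; apply: dnbhs0_lt; rewrite divr_gt0.
  rewrite -normrN opprB.
  have -> : h^-1 *: (F (h *: 1 + z) - F z) - D = h^-1 * (F (z + h) - F z - D * h).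
    by rewrite /GRing.scale /= mulr1 [h + z]addrC; field.
  rewrite normrM normfV mulrC ler_pdivrMr ?normr_gt0 //.
  apply: le_trans (H _ hd) _; rewrite expr2 mulrA ler_wpM2r //.
  rewrite ltr_pdivlMr // in he; apply: le_trans (ltW he).
  by rewrite mulrC ler_wpM2l // lerDl.
have dv : derivable F z 1 by apply/cvg_ex; exists D.
by split => //; apply/cvg_lim.
Unshelve. all: by end_near.
Qed.

(** * Mean value estimates along segments and univalence *)

Section MeanValue.
Variable R : realType.
Local Notation C := (CC R).
Implicit Types (F G : C -> C) (z d e h : C).

Lemma qderiv_is_derive F z d : qderiv F z d -> is_derive z (1 : C) F d.
Proof.
move=> [K [e [e0 K0 H]]].
apply: (@is_derive_of_quadratic _ F z d (toC K) (toC e)).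
- by rewrite -toC0 toC_lt.
- by rewrite -toC0 toC_le.
by move=> h; rewrite !cabsE -toCX -toCM toC_lt toC_le; exact: H.
Qed.

(** The form in which [lift_qderiv] exploits the bare differentiability of a Schwarz function. *)
Lemma derivable_lip F z : derivable F z (1 : C) -> bigO 1 (fun h => F (z + h) - F z).
Proof.
move=> /cvg_ex[l /cvgrPdist_le /(_ 1 ltr01)].
rewrite near_withinE near_simpl => /nbhs_ballP[e /= e0 H].
have [r er] : exists r, e = toC r.
  by exists (complex.Re e); exact/esym/(RRe_real (gtr0_real e0)).
exists (cabs l + 1), r; split.
- by rewrite -toC_lt -er.
- by rewrite addr_ge0 ?cabs_ge0.
move=> h hr; rewrite expr1.
have [->|h0] := eqVneq h 0; first by rewrite addr0 subrr !cabs0 mulr0.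
have := H h; rewrite -ball_normE /= sub0r normrN => /(_ _ h0).
rewrite er cabsE toC_lt => /(_ hr).
have -> : h^-1 *: (F (h *: 1 + z) - F z) = (F (z + h) - F z) / h.
  by rewrite /GRing.scale /= mulr1 [h + z]addrC mulrC.
rewrite cabsE -toC1 toC_le => b.
have : cabs ((F (z + h) - F z) / h) <= cabs l + 1.
  have := cabs_dist ((F (z + h) - F z) / h) l.
  rewrite -(cabsN (_ - l)) opprB; lra.
by rewrite cabsM cabsV ler_pdivrMr ?cabs_gt0.
Qed.

(** The mean value theorem with equality fails for complex values but holds for each real
    functional; the factor [c] selects the functional. *)
Lemma mvt_segment (F F' : C -> C) z h (c : C) :
  (forall t : R, 0 <= t <= 1 -> qderiv F (z + toC t * h) (F' (z + toC t * h))) ->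
  exists2 t : R, 0 <= t <= 1 &
    complex.Re (c * (F (z + h) - F z)) = complex.Re (c * (F' (z + toC t * h) * h)).
Proof.
move=> H.
pose f (t : R) := complex.Re (c * F (z + toC t * h)).
pose df (t : R) := complex.Re (c * (F' (z + toC t * h) * h)).
have D (t : R) : 0 <= t <= 1 -> is_derive t (1 : R) f (df t).
  move=> /H t1.
  have id1 : bigO 1 (fun s : C => s * h).
    by apply: bigO_ext (bigOZ h (bigO_id R)) => s; rewrite mulrC.
  have [K [e [e0 K0 {}H]]] := bigOZ c (bigO_comp t1 id1).
  apply: (@is_derive_of_quadratic _ f t _ K e) => // s hs.
  have -> : f (t + s) - f t - df t * s =
     complex.Re (c * (F (z + toC t * h + toC s * h) - F (z + toC t * h)
        - F' (z + toC t * h) * (toC s * h))).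
    rewrite /f /df toCD mulrDl addrA !ReImE; ring.
  apply: le_trans (Re_le_cabs _) _.
  by have := H (toC s); rewrite /= !cabs_toC; exact.
have cf : {within `[0, 1], continuous f}.
  apply: derivable_within_continuous => t; rewrite in_itv /= => /D.
  by case.
have Do (t : R) : t \in `]0, 1[%R -> is_derive t (1 : R) f (df t).
  by rewrite in_itv /= => /andP[a b]; apply: D; rewrite !ltW.
have [t] := MVT ltr01 Do cf.
rewrite in_itv /= => /andP[a b] e; exists t; first by rewrite !ltW.
move: e; rewrite /f /df toC0 toC1 mul0r mul1r addr0 subr0 mulr1 => <-.
by rewrite mulrBr !ReImE; ring.
Qed.

Lemma mean_value_le (F F' : C -> C) z h (K : R) :
  (forall t : R, 0 <= t <= 1 -> qderiv F (z + toC t * h) (F' (z + toC t * h))) ->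
  (forall t : R, 0 <= t <= 1 -> cabs (F' (z + toC t * h)) <= K) ->
  cabs (F (z + h) - F z) <= K * cabs h.
Proof.
move=> H HK; set v := F (z + h) - F z.
have [->|v0] := eqVneq v 0.
  rewrite cabs0 mulr_ge0 ?cabs_ge0 //.
  by apply: le_trans (HK 0 _); rewrite ?cabs_ge0 // lexx ler01.
(* This functional sends the increment [v] to 1, so the derivative term divided by [v] has modulus
   at least 1. *)
have [t t01] := mvt_segment (v^-1) H; rewrite -/v mulVf // => e.
have : 1 <= cabs (v^-1 * (F' (z + toC t * h) * h)).
  apply: le_trans (Re_le_cabs _); rewrite -e /=.
  by rewrite normr1.
rewrite !cabsM cabsV ler_pdivlMl ?cabs_gt0 // mulr1 => /le_trans; apply.
by rewrite ler_wpM2r ?cabs_ge0 // HK.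
Qed.

Lemma disc_segment z w (r : R) (t : R) : 0 <= t <= 1 ->
  cabs z < r -> cabs w < r -> cabs (z + toC t * (w - z)) < r.
Proof.
move=> /andP[t0 t1] hz hw.
have -> : z + toC t * (w - z) = toC (1 - t) * z + toC t * w.
  by rewrite toCD toCN toC1; ring.
apply: le_lt_trans (cabsD _ _) _; rewrite !cabsM !cabs_toC !ger0_norm ?subr_ge0 //.
have m1 : cabs z <= Num.max (cabs z) (cabs w) by rewrite le_max lexx.
have m2 : cabs w <= Num.max (cabs z) (cabs w) by rewrite le_max lexx orbT.
apply: (@le_lt_trans _ _ (Num.max (cabs z) (cabs w))); last by rewrite gt_max hz.
by nra.
Qed.

(** The disc is convex, so the mean value theorem applies on the segment from z to w with [c] = 1/(w
    - z): the real part of the difference quotient equals that of F' at some point, which is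
    positive. *)
Lemma noshiro_warschawski (F F' : C -> C) :
  (forall z, inD z -> qderiv F z (F' z)) ->
  (forall z, inD z -> 0 < complex.Re (F' z)) -> univalent_D F.
Proof.
move=> H P z w zD wD e; apply/eqP; apply: contraT => zw.
have h0 : w - z != 0 by rewrite subr_eq0 eq_sym.
have seg t : 0 <= t <= 1 -> inD (z + toC t * (w - z)).
  by move=> t01; apply/inDE/disc_segment => //; apply/inDE.
have [t t01] := mvt_segment ((w - z)^-1) (fun t ht => H _ (seg t ht)).
rewrite addrCA subrr addr0 e subrr mulr0 mulrC mulfK // => E.
by have := P _ (seg t t01); rewrite -E ltxx.
Qed.

End MeanValue.

(** * Taylor expansions with remainder *)

Section Peano.
Variable R : realType.
Local Notation C := (CC R).
Implicit Types (F G : C -> C) (z : C) (P Q : {poly C}).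

(** [P] is a polynomial in the displacement from z. It is not truncated: only its coefficients up to
    index [n] are determined, so sums and products of expansions need no cutting. *)
Definition peano n F z P := bigO n.+1 (fun h => F (z + h) - P.[h]).

(** A pointwise substitute for analyticity, with constants depending on the point;
    [taylor_expansion] upgrades it to a convergent series. *)
Definition smooth F := forall z, inD z -> forall n, exists P, peano n F z P.

Lemma bigO_at0 k (phi : C -> C) : bigO k.+1 phi -> phi 0 = 0.
Proof.
move=> [K [d [d0 K0 H]]]; apply/eqP; rewrite -cabs_eq0 eq_le cabs_ge0 andbT.
by have := H 0; rewrite cabs0 expr0n mulr0; exact.
Qed.

Lemma bigO_horner P : bigO 0 (horner P).
Proof.
elim/poly_ind: P => [|P c IH].
  by apply: bigO_ext (bigO0 R 0) => h; rewrite horner0.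
have : bigO 0 (fun h => P.[h] * h + c).
  apply: bigOD (bigO_cst c).
  exact: bigO_le (bigOM IH (bigO_id R)).
by apply: bigO_ext => h; rewrite hornerMXaddC.
Qed.

Lemma bigO_poly n P : (forall i, (i <= n)%N -> P`_i = 0) -> bigO n.+1 (horner P).
Proof.
move=> H; have -> : P = drop_poly n.+1 P * 'X^(n.+1).
  rewrite -{1}(poly_take_drop n.+1 P) [take_poly _ _](_ : _ = 0) ?add0r //.
  by apply/polyP => i; rewrite coef_take_poly coef0; case: ifP => // /H.
have := bigOM (bigO_horner (drop_poly n.+1 P)) (bigO_Xn R n.+1).
by apply: bigO_ext => h; rewrite hornerM hornerXn.
Qed.

Lemma peano_coef_eq n F z P Q : (forall i, (i <= n)%N -> P`_i = Q`_i) ->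
  peano n F z P -> peano n F z Q.
Proof.
move=> H FP; have : bigO n.+1 (horner (P - Q)).
  by apply: bigO_poly => i /H; rewrite coefB => ->; rewrite subrr.
move=> /(bigOD FP); apply: bigO_ext => h; rewrite hornerD hornerN; ring.
Qed.

Lemma peano_ext n F G z P : F =1 G -> peano n F z P -> peano n G z P.
Proof. by move=> e; apply: bigO_ext => h; rewrite e. Qed.

Lemma peano_near n F G z P :
  (exists2 e : R, 0 < e & forall h, cabs h < e -> F (z + h) = G (z + h)) ->
  peano n F z P -> peano n G z P.
Proof. by move=> [e e0 H]; apply: bigO_near; exists e => // h he; rewrite H. Qed.

Lemma peano_le m n F z P : (m <= n)%N -> peano n F z P -> peano m F z P.
Proof. by move=> mn; apply: bigO_le. Qed.

Lemma peano_at n F z P : peano n F z P -> P`_0 = F z.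
Proof.
move=> /bigO_at0; rewrite addr0 horner_coef0 => /eqP.
by rewrite subr_eq0 => /eqP ->.
Qed.

Lemma peano_lip n F z P : peano n F z P -> bigO 1 (fun h => F (z + h) - F z).
Proof.
move=> H; have : bigO 1 (horner (P - (P`_0)%:P)).
  by apply: bigO_poly => i; rewrite leqn0 => /eqP ->; rewrite coefB coefC subrr.
move=> /(bigOD (bigO_le (isT : (1 <= n.+1)%N) H)); apply: bigO_ext => h.
by rewrite hornerD hornerN hornerC (peano_at H); ring.
Qed.

Lemma peano_cst n c z : peano n (fun=> c) z c%:P.
Proof. by apply: bigO_ext (bigO0 R _) => h; rewrite hornerC subrr. Qed.

Lemma peano_id n z : peano n id z ('X + z%:P).
Proof. by apply: bigO_ext (bigO0 R _) => h; rewrite !hornerE /=; ring. Qed.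

Lemma peanoD n F G z P Q : peano n F z P -> peano n G z Q ->
  peano n (fun y => F y + G y) z (P + Q).
Proof. by move=> hF /(bigOD hF); apply: bigO_ext => h; rewrite !hornerE /=; ring. Qed.

Lemma peanoN n F z P : peano n F z P -> peano n (fun y => - F y) z (- P).
Proof. by move=> /bigON; apply: bigO_ext => h; rewrite !hornerE /=; ring. Qed.

Lemma peanoB n F G z P Q : peano n F z P -> peano n G z Q ->
  peano n (fun y => F y - G y) z (P - Q).
Proof. by move=> hF /peanoN; exact: peanoD. Qed.

Lemma peano_bounded n F z P : peano n F z P -> bigO 0 (fun h => F (z + h)).
Proof.
move=> H; have := bigOD (bigO_le (leq0n _) H) (bigO_horner P).
by apply: bigO_ext => h; rewrite subrK.
Qed.

Lemma peanoM n F G z P Q : peano n F z P -> peano n G z Q ->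
  peano n (fun y => F y * G y) z (P * Q).
Proof.
move=> hF hG.
have := bigOD (bigOM (peano_bounded hF) hG) (bigOM (bigO_horner Q) hF).
by apply: bigO_ext => h; rewrite !hornerE /=; ring.
Qed.

Lemma peanoZ n F z P c : peano n F z P -> peano n (fun y => c * F y) z (c *: P).
Proof. by move=> /(peanoM (peano_cst n c z)); rewrite mul_polyC. Qed.

Lemma peanoX n F z P k : peano n F z P -> peano n (fun y => F y ^+ k) z (P ^+ k).
Proof.
move=> H; elim: k => [|k IH]; first exact: peano_cst.
by rewrite exprS; apply: peano_ext (peanoM H IH) => y; rewrite exprS.
Qed.

Lemma peano_sum n z (I : Type) (r : seq I) (F : I -> C -> C) (P : I -> {poly C}) :
  (forall i, peano n (F i) z (P i)) ->
  peano n (fun y => \sum_(i <- r) F i y) z (\sum_(i <- r) P i).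
Proof.
move=> H; elim: r => [|i r IH].
  by rewrite big_nil; apply: peano_ext (peano_cst n 0 z) => y; rewrite big_nil.
by rewrite big_cons; apply: peano_ext (peanoD (H i) IH) => y; rewrite big_cons.
Qed.

Lemma peano_horner n P z : exists Q, peano n (horner P) z Q.
Proof.
elim/poly_ind: P => [|P c [Q IH]].
  by exists 0%:P; apply: peano_ext (peano_cst n 0 z) => y; rewrite horner0.
eexists; apply: peano_ext (peanoD (peanoM IH (peano_id n z)) (peano_cst n c z)) => y.
by rewrite hornerMXaddC.
Qed.

Lemma peanoV n F z P : F z != 0 -> peano n F z P ->
  exists Q, peano n (fun y => (F y)^-1) z Q.
Proof.
move=> Fz H; have P0 := peano_at H.
(* Truncated geometric series: [N] has no constant term, so N^(n+1) = O(h^(n+1)), and P Q = 1 -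
   N^(n+1). Then 1/F - Q = (N^(n+1) - Q (F - P)) / F. *)
pose N := 1 - (F z)^-1 *: P.
have [hi [e e0 ne]] := bigO_inv Fz (peano_lip H).
have N1 : bigO 1 (horner N).
  apply: bigO_poly => i; rewrite leqn0 => /eqP ->.
  by rewrite coefB coef1 coefZ P0 mulVf ?subrr.
have Nn : bigO n.+1 (fun h => N.[h] ^+ n.+1).
  elim: n {H} => [|n IH]; first exact: N1.
  by apply: bigO_ext (bigOM N1 IH) => h; rewrite -exprS.
pose Q := (F z)^-1 *: \sum_(i < n.+1) N ^+ i.
exists Q; apply: bigO_near (bigOM hi (bigOB Nn (bigOM (bigO_horner Q) H))).
exists e => // h /ne nz.
have PQ : P.[h] * Q.[h] = 1 - N.[h] ^+ n.+1.
  rewrite /Q hornerZ horner_sum -[RHS]opprB subrX1 -mulNr opprB.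
  have -> : 1 - N.[h] = (F z)^-1 * P.[h] by rewrite /N !hornerE; ring.
  have -> : \sum_(i < n.+1) (N ^+ i).[h] = \sum_(i < n.+1) N.[h] ^+ i.
    by apply: eq_bigr => i _; rewrite horner_exp.
  ring.
apply: (mulfI nz); rewrite mulVKf // [RHS]mulrBr mulfV //.
have -> : N.[h] ^+ n.+1 = 1 - P.[h] * Q.[h] by rewrite PQ opprB addrCA subrr addr0.
ring.
Qed.

Lemma peano_scale n F z c P : peano n F (c * z) P ->
  peano n (fun y => F (c * y)) z (P \Po (c *: 'X)).
Proof.
move=> H; have l : bigO 1 (fun h : C => c * h) := bigOZ c (bigO_id R).
apply: bigO_ext (bigO_comp H l) => h /=.
by rewrite horner_comp !hornerE mulrDr.
Qed.

Lemma bigO_Xn_lt k n : (k < n)%N -> ~ bigO n (fun h : C => h ^+ k).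
Proof.
move=> kn [K [d [d0 K0 H]]].
pose t := Num.min (d / 2) (Num.min 1 ((K + 1)^-1 / 2)).
have K1 : 0 < (K + 1)^-1 by rewrite invr_gt0 ltr_wpDl.
have t0 : 0 < t by rewrite !lt_min ltr01 !divr_gt0.
have td : t < d by rewrite /t gt_min; apply/orP; left; lra.
have t1 : t <= 1 by rewrite /t !ge_min lexx orbT.
have tK : K * t < 1.
  apply: (@le_lt_trans _ _ (K * ((K + 1)^-1 / 2))).
    by rewrite ler_wpM2l // /t !ge_min lexx !orbT.
  rewrite mulrA ltr_pdivrMr // mul1r ltr_pdivrMr ?ltr_wpDl //; lra.
have := H (toC t); rewrite cabs_toC gtr0_norm // => /(_ td).
rewrite cabsX cabs_toC gtr0_norm // -(subnKC (ltnW kn)) exprD mulrCA.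
rewrite -[X in X <= _]mulr1 ler_pM2l ?exprn_gt0 // => h.
have : K * t ^+ (n - k) <= K * t.
  rewrite ler_wpM2l // -[X in _ <= X]expr1 ler_wiXn2l ?(ltW t0) //.
  by rewrite subn_gt0.
lra.
Qed.

(** At the first nonzero coefficient P = X^i Q with Q(0) nonzero; dividing by Q would make h^i
    itself O(h^(n+1)). *)
Lemma bigO_poly_coef n P : bigO n.+1 (horner P) -> forall i, (i <= n)%N -> P`_i = 0.
Proof.
move=> H; elim/ltn_ind => i IH iln; apply/eqP; apply: contraT => Pi.
have [Q [PE Qi]] : exists Q, P = Q * 'X^i /\ Q.[0] != 0.
  exists (drop_poly i P); split.
    rewrite -{1}(poly_take_drop i P) [take_poly _ _](_ : _ = 0) ?add0r //.
    apply/polyP => j; rewrite coef_take_poly coef0; case: ifP => // ji.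
    by rewrite IH // (leq_trans (ltnW ji)).
  by rewrite horner_coef0 coef_drop_poly add0n.
have lip : bigO 1 (fun h => Q.[0 + h] - Q.[0]).
  have [q hq] := peano_horner 0 Q 0; exact: peano_lip hq.
have [hi [e e0 ne]] := bigO_inv Qi lip.
have iln' : (i < n.+1)%N by [].
case: (bigO_Xn_lt iln'); apply: bigO_near (bigOM hi H).
exists e => // h /ne nz; rewrite PE hornerM hornerXn; move: nz; rewrite add0r => nz.
by rewrite mulKf.
Qed.

Lemma peano_uniq n F z P Q : peano n F z P -> peano n F z Q ->
  forall i, (i <= n)%N -> P`_i = Q`_i.
Proof.
move=> HP HQ i iln.
have : bigO n.+1 (horner (P - Q)).
  apply: bigO_ext (bigOB HQ HP) => h; rewrite !hornerE /=; ring.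
by move=> /bigO_poly_coef/(_ _ iln); rewrite coefB => /subr0_eq.
Qed.

Lemma qderiv_horner P z : qderiv (horner P) z P^`().[z].
Proof.
elim/poly_ind: P => [|P c IH].
  rewrite deriv0 horner0; apply: qderiv_ext (qderiv_cst 0 z) => y.
  by rewrite horner0.
have := qderivD (qderivM IH (qderiv_id z)) (qderiv_cst c z).
rewrite derivD derivC addr0 derivM derivX mulr1 !hornerE.
by apply: qderiv_ext => y; rewrite hornerMXaddC.
Qed.

Definition primitive_poly (c : C) P : {poly C} :=
  \poly_(i < (size P).+1) (if i is j.+1 then P`_j / j.+1%:R else c).

Lemma coef_primitive c P i :
  (primitive_poly c P)`_i = if i is j.+1 then P`_j / j.+1%:R else c.
Proof.
rewrite coef_poly ltnS; case: leqP => //; case: i => // i.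
by rewrite ltnS => /leq_sizeP/(_ _ (leqnn _)) ->; rewrite mul0r.
Qed.

Lemma deriv_primitive c P : deriv (primitive_poly c P) = P.
Proof.
apply/polyP => i; rewrite coef_deriv coef_primitive -[LHS]mulr_natr mulfVK // pnatr_eq0.
Qed.

(** Integration without integrals: F minus the formal primitive of P has derivative G - P =
    O(h^(n+1)), and the mean value estimate contributes one more factor |h|. *)
Lemma peano_primitive n F G z P :
  (exists2 e : R, 0 < e & forall h, cabs h < e -> qderiv F (z + h) (G (z + h))) ->
  peano n G z P -> peano n.+1 F z (primitive_poly (F z) P).
Proof.
move=> [e e0 HF] [K [d [d0 K0 H]]].
set Q := primitive_poly _ _.
pose psi (y : C) := F y - Q.[y - z].
pose psi' (y : C) := G y - P.[y - z].
have D h : cabs h < e -> qderiv psi (z + h) (psi' (z + h)).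
  move=> /HF Fh; apply: qderivB => //.
  have sh : qderiv (fun y => y - z) (z + h) 1.
    have := qderivB (qderiv_id (z + h)) (qderiv_cst z (z + h)).
    by rewrite subr0.
  have := @qderiv_comp _ (horner Q) (fun y => y - z) _ _ _ (qderiv_horner Q (z + h - z)) sh.
  by rewrite mulr1 deriv_primitive.
exists K, (Num.min e d); split; rewrite ?lt_min ?e0 // => h.
rewrite lt_min => /andP[he hd].
have th t : 0 <= t <= 1 -> cabs (toC t * h) <= cabs h.
  move=> /andP[t0 t1]; rewrite cabsM cabs_toC ger0_norm //.
  by rewrite ler_piMl ?cabs_ge0.
have -> : F (z + h) - Q.[h] = psi (z + h) - psi z.
  rewrite /psi subrr horner_coef0 coef_primitive subrr subr0.
  by rewrite [z + h]addrC addrK.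
rewrite [_ ^+ _]exprSr mulrA; apply: (@mean_value_le _ psi psi') => t t01.
  by apply: D; exact: le_lt_trans (th _ t01) he.
rewrite /psi' [_ - z]addrAC subrr add0r.
apply: le_trans (H _ (le_lt_trans (th _ t01) hd)) _.
by rewrite ler_wpM2l // lerXn2r ?nnegrE ?cabs_ge0 ?th.
Qed.

Lemma inD_near z : inD z ->
  exists2 e : R, 0 < e & forall h, cabs h < e -> inD (z + h).
Proof.
move=> /inDE zD; exists (1 - cabs z); first by rewrite subr_gt0.
move=> h hh; apply/inDE; apply: le_lt_trans (cabsD _ _) _; lra.
Qed.

Lemma smooth_ext F G : (forall z, inD z -> F z = G z) -> smooth F -> smooth G.
Proof.
move=> FG sF z zD n; have [P FP] := sF z zD n; exists P.
apply: peano_near FP; have [e e0 He] := inD_near zD.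
by exists e => // h /He/FG.
Qed.

Lemma smooth_cst c : smooth (fun=> c).
Proof. by move=> z _ n; eexists; exact: peano_cst. Qed.

Lemma smoothD F G : smooth F -> smooth G -> smooth (fun y => F y + G y).
Proof.
move=> sF sG z zD n; have [[P FP] [Q GQ]] := (sF z zD n, sG z zD n).
by eexists; exact: peanoD FP GQ.
Qed.

Lemma smoothM F G : smooth F -> smooth G -> smooth (fun y => F y * G y).
Proof.
move=> sF sG z zD n; have [[P FP] [Q GQ]] := (sF z zD n, sG z zD n).
by eexists; exact: peanoM FP GQ.
Qed.

Lemma smoothX F k : smooth F -> smooth (fun y => F y ^+ k).
Proof.
move=> sF z zD n; have [P FP] := sF z zD n.
by eexists; exact: peanoX FP.
Qed.

Lemma smoothV F : (forall z, inD z -> F z != 0) -> smooth F ->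
  smooth (fun y => (F y)^-1).
Proof.
move=> F0 sF z zD n; have [P FP] := sF z zD n.
exact: peanoV (F0 _ zD) FP.
Qed.

Lemma smooth_horner P : smooth (horner P).
Proof. by move=> z _ n; exact: peano_horner. Qed.

Lemma smooth_primitive F G : (forall z, inD z -> qderiv F z (G z)) ->
  smooth G -> smooth F.
Proof.
move=> H sG z zD n; have [P GP] := sG z zD n; exists (primitive_poly (F z) P).
apply: peano_le (leqnSn n) _; apply: peano_primitive GP.
by have [e e0 He] := inD_near zD; exists e => // h /He/H.
Qed.

End Peano.

(** * Power series on the unit disc *)

Section PowerSeries.
Variable R : realType.
Local Notation C := (CC R).
Implicit Types (F G : C -> C) (z h : C) (a b : nat -> C).

Definition psum a z n := \sum_(k < n) a k * z ^+ k.

Definition psconv a z (s : C) :=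
  forall e : R, 0 < e -> exists N, forall n, (N <= n)%N -> cabs (psum a z n - s) < e.

(** Radius of convergence at least 1, phrased so that multiplying or dividing the coefficients by
    the index preserves it. *)
Definition subgeometric a :=
  forall r : R, 0 <= r -> r < 1 -> exists M, forall k, cabs (a k) * r ^+ k <= M.

Definition dcoef a k := k.+1%:R * a k.+1.

Definition icoef a k := if k is j.+1 then a j / j.+1%:R else 0.

Lemma psconvP a z s : psconv a z s <-> (series (fun n => a n * z ^+ n) @ \oo --> s).
Proof.
have E n : series (fun n => a n * z ^+ n) n = psum a z n by rewrite /series /= big_mkord.
split=> [H|/cvgrPdist_lt H e e0].
  apply/cvgrPdist_lt => e e0.
  have er : e = toC (complex.Re e) by exact/esym/(RRe_real (gtr0_real e0)).
  have [|N HN] := H (complex.Re e); first by rewrite -toC_lt -er.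
  exists N => // n /= /HN; rewrite E -normrN opprB er cabsE toC_lt; exact.
have [|N _ HN] := H (toC e); first by rewrite -toC0 toC_lt.
exists N => n /HN; rewrite E -normrN opprB cabsE toC_lt; exact.
Qed.

Lemma taylorP F a : taylor_D F a <-> forall z, inD z -> psconv a z (F z).
Proof. by split=> H z /H /psconvP. Qed.

Lemma psconv_uniq a z s t : psconv a z s -> psconv a z t -> s = t.
Proof.
move=> Hs Ht; apply/eqP; rewrite -subr_eq0 -cabs_eq0 eq_le cabs_ge0 andbT leNgt.
apply/negP => st0; have e0 : 0 < cabs (s - t) / 2 by rewrite divr_gt0.
have [[N1 H1] [N2 H2]] := (Hs _ e0, Ht _ e0).
have := H1 _ (leq_maxl N1 N2); have := H2 _ (leq_maxr N1 N2).
set u := psum _ _ _ => hu ku.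
have : cabs (s - t) <= cabs (u - t) + cabs (u - s).
  by rewrite -(_ : (u - t) - (u - s) = s - t) ?cabsB //; ring.
lra.
Qed.

Lemma psum0 a n : psum a 0 n.+1 = a 0%N.
Proof.
rewrite /psum big_ord_recl expr0 mulr1 big1 ?addr0 // => i _.
by rewrite exprS mul0r mulr0.
Qed.

Lemma psconv0 a s : psconv a 0 s -> s = a 0%N.
Proof.
move=> H; apply: psconv_uniq H _ => e e0; exists 1%N => -[//|n] _.
by rewrite psum0 subrr cabs0.
Qed.

Lemma geometric_bound (q : R) n : 0 <= q -> q < 1 -> \sum_(i < n) q ^+ i <= (1 - q)^-1.
Proof.
move=> q0 q1; have q1' : 0 < 1 - q by rewrite subr_gt0.
rewrite -[X in _ <= X]mul1r ler_pdivlMr // mulrC -[1 - q]opprB mulNr -subrX1 opprB.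
by rewrite gerBl exprn_ge0.
Qed.

Lemma natr_geometric_bound (q : R) n : 0 <= q -> q < 1 -> n%:R * q ^+ n <= (1 - q)^-1.
Proof.
move=> q0 q1; apply: le_trans (geometric_bound n q0 q1).
rewrite mulr_natl -[n in _ *+ n]card_ord -sumr_const.
by apply: ler_sum => i _; rewrite ler_wiXn2l ?(ltW q1) // ltnW.
Qed.

Lemma subgeometric_of_psconv a F : (forall z, inD z -> psconv a z (F z)) -> subgeometric a.
Proof.
move=> H r r0 r1.
have rD : inD (toC r) by apply/inDE; rewrite cabs_toC ger0_norm.
have [N HN] := H _ rD 1 ltr01.
(* From index [N] on, a term is the difference of two partial sums within 1 of the limit; the finite
   sum covers the earlier terms. *)
exists (2 + \sum_(i < N) cabs (a i) * r ^+ i) => k.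
have [Nk|kN] := leqP N k; last first.
  rewrite (bigD1 (Ordinal kN)) //= addrCA lerDl addr_ge0 //.
  by apply: sumr_ge0 => i _; rewrite mulr_ge0 ?cabs_ge0 ?exprn_ge0.
have h1 := HN _ Nk; have h2 := HN _ (leqW Nk).
have E : a k * toC r ^+ k = (psum a (toC r) k.+1 - F (toC r)) - (psum a (toC r) k - F (toC r)).
  by rewrite /psum big_ord_recr /=; ring.
have := cabsB (psum a (toC r) k.+1 - F (toC r)) (psum a (toC r) k - F (toC r)).
rewrite -E cabsM cabsX cabs_toC ger0_norm //.
have : 0 <= \sum_(i < N) cabs (a i) * r ^+ i.
  by apply: sumr_ge0 => i _; rewrite mulr_ge0 ?cabs_ge0 ?exprn_ge0.
lra.
Qed.

Lemma subgeometric_sum a (r : R) : subgeometric a -> 0 <= r -> r < 1 ->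
  exists2 M : R, 0 <= M & forall n, \sum_(k < n) cabs (a k) * r ^+ k <= M.
Proof.
move=> H r0 r1; pose s := (1 + r) / 2.
have s0 : 0 < s by rewrite /s; lra.
have s1 : s < 1 by rewrite /s; lra.
have rs : r < s by rewrite /s; lra.
have [M HM] := H s (ltW s0) s1.
have M0 : 0 <= M.
  by apply: le_trans (HM 0%N); rewrite mulr_ge0 ?cabs_ge0 ?exprn_ge0 // ltW.
have q0 : 0 <= r / s by rewrite divr_ge0 // ltW.
have q1 : r / s < 1 by rewrite ltr_pdivrMr // mul1r.
exists (M * (1 - r / s)^-1); first by rewrite mulr_ge0 // invr_ge0 subr_ge0 ltW.
move=> n; apply: le_trans (_ : M * \sum_(k < n) (r / s) ^+ k <= _); last first.
  by rewrite ler_wpM2l // geometric_bound.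
rewrite mulr_sumr; apply: ler_sum => k _.
rewrite -[X in _ * X ^+ _](divfK (lt0r_neq0 s0)) exprMn mulrA mulrAC.
by rewrite ler_wpM2r ?exprn_ge0.
Qed.

Lemma subgeometric_natr a : subgeometric a -> subgeometric (fun k => k%:R * a k).
Proof.
move=> H r r0 r1; pose s := (1 + r) / 2.
have s0 : 0 < s by rewrite /s; lra.
have s1 : s < 1 by rewrite /s; lra.
have rs : r < s by rewrite /s; lra.
have [M HM] := H s (ltW s0) s1.
have q0 : 0 <= r / s by rewrite divr_ge0 // ltW.
have q1 : r / s < 1 by rewrite ltr_pdivrMr // mul1r.
exists ((1 - r / s)^-1 * M) => k.
rewrite cabsM cabs_nat -[X in _ * X ^+ _](divfK (lt0r_neq0 s0)) exprMn.
have -> : k%:R * cabs (a k) * ((r / s) ^+ k * s ^+ k) =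
  (k%:R * (r / s) ^+ k) * (cabs (a k) * s ^+ k) by ring.
by rewrite ler_pM ?mulr_ge0 ?cabs_ge0 ?exprn_ge0 ?natr_geometric_bound // ltW.
Qed.

Lemma subgeometric_dcoef a : subgeometric a -> subgeometric (dcoef a).
Proof.
move=> /subgeometric_natr H r r0 r1; pose s := (1 + r) / 2.
have s0 : 0 < s by rewrite /s; lra.
have s1 : s < 1 by rewrite /s; lra.
have rs : r <= s by rewrite /s; lra.
have [M HM] := H s (ltW s0) s1; exists (s^-1 * M) => k.
rewrite ler_pdivlMl //; apply: le_trans (HM k.+1).
rewrite mulrCA exprS ler_wpM2l ?cabs_ge0 //.
rewrite ler_wpM2l ?(ltW s0) // lerXn2r ?nnegrE // ltW //.
Qed.

Lemma subgeometric_icoef a : subgeometric a -> subgeometric (icoef a).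
Proof.
move=> H r r0 r1; have [M HM] := H r r0 r1; exists M => -[|k] /=.
  rewrite cabs0 mul0r; apply: le_trans (HM 0%N).
  by rewrite mulr_ge0 ?cabs_ge0 ?exprn_ge0.
apply: le_trans (HM k); rewrite cabsM cabsV cabs_nat exprS.
have -> : cabs (a k) / k.+1%:R * (r * r ^+ k) = cabs (a k) * r ^+ k * (r / k.+1%:R) by ring.
rewrite ler_piMr ?mulr_ge0 ?cabs_ge0 ?exprn_ge0 //.
rewrite ler_pdivrMr // mul1r (le_trans (ltW r1)) // ler1n //.
Qed.

(** Absolute convergence is used on real and imaginary parts separately, so only the completeness of
    [R] enters. *)
Lemma psconv_ex a : subgeometric a -> exists F, forall z, inD z -> psconv a z (F z).
Proof.
move=> H; suff /choice[F HF] : forall z, exists s, inD z -> psconv a z s by exists F.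
move=> z; have [zD|zD] := pselect (inD z); last by exists 0.
have z1 : cabs z < 1 by apply/inDE.
have [M M0 HM] := subgeometric_sum H (cabs_ge0 z) z1.
have cv (x : nat -> R) : (forall k, `|x k| <= cabs (a k) * cabs z ^+ k) ->
    cvgn (series x).
  move=> Hx; apply: normed_cvg; apply: nondecreasing_is_cvgn.
    by apply: nondecreasing_series => ? ? ?; exact: normr_ge0.
  exists M => _ [n _ <-]; rewrite /normed_series_of /series /= big_mkord; apply: le_trans (HM n).
  by apply: ler_sum => i _; exact: Hx.
have cr : cvgn (series (fun k => complex.Re (a k * z ^+ k))).
  by apply: cv => k; apply: le_trans (Re_le_cabs _) _; rewrite cabsM cabsX.
have ci : cvgn (series (fun k => complex.Im (a k * z ^+ k))).
  by apply: cv => k; apply: le_trans (Im_le_cabs _) _; rewrite cabsM cabsX.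
exists ((limn (series (fun k => complex.Re (a k * z ^+ k))) +i*
  limn (series (fun k => complex.Im (a k * z ^+ k))))%C : C) => _ e e0.
have e2 : 0 < e / 2 by rewrite divr_gt0.
move: cr => /cvgrPdist_lt/(_ _ e2)[N1 _ H1].
move: ci => /cvgrPdist_lt/(_ _ e2)[N2 _ H2].
exists (maxn N1 N2) => n; rewrite geq_max => /andP[/H1 + /H2].
rewrite /= /series /= !big_mkord => h1 h2.
have Rs : complex.Re (psum a z n) = \sum_(i < n) complex.Re (a i * z ^+ i).
  by rewrite /psum; elim/big_ind2: _ => // x1 x2 y1 y2 <- <-; rewrite Re_add.
have Is : complex.Im (psum a z n) = \sum_(i < n) complex.Im (a i * z ^+ i).
  by rewrite /psum; elim/big_ind2: _ => // x1 x2 y1 y2 <- <-; rewrite Im_add.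
apply: le_lt_trans (cabs_le_ReIm _) _; rewrite !(Re_add, Re_opp, Im_add, Im_opp) Rs Is /=.
rewrite distrC in h1; rewrite distrC in h2; lra.
Qed.

(* Multiplied by r^2 in order to avoid the exponent n - 2. *)
Lemma expr_second_order z h (r : R) n : cabs z <= r -> cabs (z + h) <= r ->
  r ^+ 2 * cabs ((z + h) ^+ n - z ^+ n - n%:R * z ^+ n.-1 * h) <=
  n%:R ^+ 2 * r ^+ n * cabs h ^+ 2.
Proof.
move=> zr zhr; have r0 : 0 <= r := le_trans (cabs_ge0 z) zr.
elim: n => [|n IH]; first by rewrite !expr0 subrr mul0r mul0r subr0 cabs0 mulr0 expr0n !mul0r.
set D := _ - _ - _ in IH.
have -> : (z + h) ^+ n.+1 - z ^+ n.+1 - n.+1%:R * z ^+ n.+1.-1 * h =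
    n%:R * z ^+ n.-1 * h ^+ 2 + (z + h) * D.
  rewrite /D; case: (n) => [|m]; first by rewrite !expr0 !expr1; ring.
  by rewrite /= !exprS -[m.+2]addn1 natrD; ring.
have -> : (n.+1%:R : R) = n%:R + 1 by rewrite -addn1 natrD.
apply: (@le_trans _ _ (r ^+ 2 * (n%:R * cabs (z ^+ n.-1) * cabs h ^+ 2) + r * (r ^+ 2 * cabs D))).
  rewrite [r * (r ^+ 2 * _)]mulrCA -mulrDr ler_wpM2l ?exprn_ge0 //.
  apply: le_trans (cabsD _ _) _; apply: lerD.
    by rewrite cabsM cabsM cabs_nat (cabsX h).
  by rewrite cabsM ler_wpM2r ?cabs_ge0.
have A : r ^+ 2 * (n%:R * cabs (z ^+ n.-1) * cabs h ^+ 2) <= n%:R * r ^+ n.+1 * cabs h ^+ 2.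
  case: (n) => [|m] /=; first by rewrite !mul0r mulr0.
  rewrite mulrA ler_wpM2r ?exprn_ge0 ?cabs_ge0 //.
  rewrite mulrCA ler_wpM2l // [r ^+ m.+2](exprD r 2 m) ler_wpM2l ?exprn_ge0 //.
  by rewrite cabsX lerXn2r ?nnegrE ?cabs_ge0.
have B : r * (r ^+ 2 * cabs D) <= n%:R ^+ 2 * r ^+ n.+1 * cabs h ^+ 2.
  have -> : n%:R ^+ 2 * r ^+ n.+1 * cabs h ^+ 2 = r * (n%:R ^+ 2 * r ^+ n * cabs h ^+ 2).
    by rewrite [r ^+ n.+1]exprS; ring.
  by rewrite ler_wpM2l.
apply: le_trans (lerD A B) _; rewrite -!mulrDl ler_wpM2r ?exprn_ge0 ?cabs_ge0 //.
rewrite ler_wpM2r ?exprn_ge0 //.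
have : (0 : R) <= n%:R by []. nra.
Qed.

Lemma psconv_qderiv a F G : (forall z, inD z -> psconv a z (F z)) ->
  (forall z, inD z -> psconv (dcoef a) z (G z)) ->
  forall z, inD z -> qderiv F z (G z).
Proof.
move=> HF HG z zD.
(* The quadratic remainder of z^k is at most k^2 r^(k-2) |h|^2, hence the factor k twice. The
   resulting bound on partial sums is uniform in their length and survives the limit. *)
have sa := subgeometric_natr (subgeometric_natr (subgeometric_of_psconv HF)).
have [e e0 He] := inD_near zD; have z1 : cabs z < 1 by apply/inDE.
pose r := (1 + cabs z) / 2; have z0 := cabs_ge0 z.
have r0 : 0 < r by rewrite /r; lra.
have r1 : r < 1 by rewrite /r; lra.
have zr : cabs z <= r by rewrite /r; lra.
have [M M0 HM] := subgeometric_sum sa (ltW r0) r1.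
exists (M / r ^+ 2), (Num.min e (r - cabs z)); split.
- by rewrite lt_min e0 subr_gt0 /r; lra.
- by rewrite divr_ge0 // exprn_ge0 // ltW.
move=> h; rewrite lt_min => /andP[/He hD hr].
have zhr : cabs (z + h) <= r by apply: le_trans (cabsD _ _) _; lra.
have Hn n : cabs (psum a (z + h) n.+1 - psum a z n.+1 - psum (dcoef a) z n * h)
    <= M / r ^+ 2 * cabs h ^+ 2.
  have -> : psum a (z + h) n.+1 - psum a z n.+1 - psum (dcoef a) z n * h =
      \sum_(k < n.+1) a k * ((z + h) ^+ k - z ^+ k - k%:R * z ^+ k.-1 * h).
    have -> : psum (dcoef a) z n * h = \sum_(k < n.+1) a k * (k%:R * z ^+ k.-1 * h).
      rewrite big_ord_recl /= !mul0r mulr0 add0r /psum mulr_suml.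
      by apply: eq_bigr => i _; rewrite /dcoef /bump /= add1n; ring.
    by rewrite /psum -!sumrB; apply: eq_bigr => i _; ring.
  apply: le_trans (cabs_sum _ _ _) _.
  rewrite mulrAC ler_pdivlMr ?exprn_gt0 // mulrC mulr_sumr.
  apply: le_trans (_ : \sum_(k < n.+1) cabs (k%:R * (k%:R * a k)) * r ^+ k * cabs h ^+ 2 <= _).
    apply: ler_sum => k _; rewrite !cabsM !cabs_nat mulrCA.
    have := ler_wpM2l (cabs_ge0 (a k)) (expr_second_order k zr zhr).
    by move=> /le_trans; apply; rewrite le_eqVlt; apply/orP; left; apply/eqP; ring.
  by rewrite -mulr_suml ler_wpM2r ?exprn_ge0 ?cabs_ge0.
apply/ler_addgt0Pr => eps eps0.
(* The error of the derivative series gets multiplied by |h|; dividing by |h| + 1 instead of |h|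
   keeps h = 0 admissible. *)
have h1 : 0 < cabs h + 1 by rewrite ltr_wpDl ?cabs_ge0.
have e3 : 0 < eps / 3 by rewrite divr_gt0.
have e4 : 0 < eps / 3 / (cabs h + 1) by rewrite divr_gt0.
have [N1 H1] := HF _ hD _ e3; have [N2 H2] := HF _ zD _ e3.
have [N3 H3] := HG _ zD _ e4; pose n := maxn N1 (maxn N2 N3).
have {}H1 : cabs (psum a (z + h) n.+1 - F (z + h)) < eps / 3.
  by apply: H1; rewrite leqW // leq_maxl.
have {}H2 : cabs (psum a z n.+1 - F z) < eps / 3.
  by apply: H2; rewrite leqW // leq_max leq_maxl orbT.
have {}H3 : cabs (psum (dcoef a) z n - G z) * cabs h <= eps / 3.
  have : cabs (psum (dcoef a) z n - G z) < eps / 3 / (cabs h + 1).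
    by apply: H3; rewrite !leq_max leqnn !orbT.
  rewrite ltr_pdivlMr // => /ltW; apply: le_trans.
  by rewrite ler_wpM2l ?cabs_ge0 // lerDl.
set X := psum a (z + h) n.+1 in H1; set Y := psum a z n.+1 in H2.
set Z := psum (dcoef a) z n in H3; have {}Hn := Hn n; rewrite -/X -/Y -/Z in Hn.
have -> : F (z + h) - F z - G z * h =
  (X - Y - Z * h) - (X - F (z + h)) + (Y - F z) + (Z - G z) * h by ring.
apply: le_trans (cabsD _ _) _; rewrite cabsM.
have := cabsD ((X - Y - Z * h) - (X - F (z + h))) (Y - F z).
have := cabsB (X - Y - Z * h) (X - F (z + h)).
lra.
Qed.

(** Each order comes from integrating the expansion of the termwise derivative. The coefficients are
    identified only at the centre, hence the conditional second part. *)
Lemma psconv_peano n a F : (forall z, inD z -> psconv a z (F z)) ->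
  forall z, inD z -> exists2 P, peano n F z P &
    z = 0 -> forall i, (i <= n)%N -> P`_i = a i.
Proof.
elim: n a F => [|n IH] a F HF z zD;
  have [G HG] := psconv_ex (subgeometric_dcoef (subgeometric_of_psconv HF));
  have D := psconv_qderiv HF HG.
  exists (F z)%:P.
    by apply: bigO_ext (qderiv_lip (D _ zD)) => h; rewrite hornerC.
  move=> z0 i; rewrite leqn0 => /eqP ->; rewrite coefC /= z0.
  by apply: psconv0; apply: HF; rewrite -z0.
have [P GP P0] := IH _ _ HG z zD; exists (primitive_poly (F z) P).
  apply: peano_primitive GP; have [e e0 He] := inD_near zD.
  by exists e => // h /He/D.
move=> z0 [|i] iln; rewrite coef_primitive.
  by rewrite z0; apply: psconv0; apply: HF; rewrite -z0.
by rewrite P0 // /dcoef mulrC mulKf // pnatr_eq0.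
Qed.

Lemma psconv_smooth a F : (forall z, inD z -> psconv a z (F z)) -> smooth F.
Proof. by move=> H z zD n; have [P FP _] := psconv_peano n H zD; exists P. Qed.

End PowerSeries.

(** * The function sqrt(1 + tanh z) *)

Section RealBounds.
Variable R : realType.
Implicit Types x y : R.

Lemma sin_dist_le y : `|sin y| <= `|y|.
Proof.
wlog y0 : y / 0 <= y.
  move=> H; case: (leP 0 y) => [/H //|/ltW y0].
  by rewrite -(opprK y) sinN !(normrN (sin _), normrN (- y)) H // oppr_ge0.
have dS (x : R) : x \in `]0, y[%R -> is_derive x 1 (@sin R) (cos x).
  by move=> _; exact: is_derive_sin.
have cS : {within `[0, y], continuous (@sin R)}.
  by apply: continuous_subspaceT => x; exact: continuous_sin.
have [c _] := MVT_segment y0 dS cS; rewrite sin0 !subr0 => ->.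
by rewrite normrM ler_piMl // cos_max.
Qed.

Lemma one_minus_cos_le y : `|1 - cos y| <= y ^+ 2.
Proof.
have E : 1 - cos y = 2 * sin (y / 2) ^+ 2.
  have -> : cos y = cos (y / 2 + y / 2) by congr cos; lra.
  rewrite cosD; have := cos2Dsin2 (y / 2); lra.
have : `|sin (y / 2)| ^+ 2 <= `|y / 2| ^+ 2.
  by rewrite lerXn2r ?nnegrE ?normr_ge0 ?sin_dist_le.
rewrite E !real_normK ?num_real // => h.
have s0 := sqr_ge0 (sin (y / 2)); rewrite ger0_norm; last by lra.
by have := sqr_ge0 y; lra.
Qed.

Lemma sin_sub_id_le y : `|y| <= 1 -> `|sin y - y| <= y ^+ 2.
Proof.
wlog y0 : y / 0 <= y.
  move=> H; case: (leP 0 y) => [/H //|/ltW y0] y1.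
  have := H (- y); rewrite oppr_ge0 normrN sqrrN sinN -opprD normrN; exact.
rewrite ger0_norm // => y1.
have dS (x : R) : x \in `]0, y[%R -> is_derive x 1 (fun x : R => sin x - x) (cos x - 1).
  by move=> _; apply: is_deriveB.
have cS : {within `[0, y], continuous (fun x : R => sin x - x)}.
  apply: continuous_subspaceT => x; apply: cvgB; last exact: cvg_id.
  exact: continuous_sin.
have [c] := MVT_segment y0 dS cS.
rewrite in_itv /= => /andP[c0 cy]; rewrite sin0 !subr0 => ->.
rewrite normrM distrC (ger0_norm y0).
have := one_minus_cos_le c; have : c ^+ 2 <= y by nra.
have := normr_ge0 (1 - cos c); nra.
Qed.

(** Both sides come from 1 + x <= exp x: at -x it reads (1 - x) exp x <= 1, which is the upper
    bound. *)
Lemma expR_sub_le x : `|x| <= 2^-1 -> `|expR x - 1 - x| <= 2 * x ^+ 2.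
Proof.
rewrite ler_norml => /andP[x1 x2].
have lo := expR_ge1Dx x; have := expR_ge1Dx (- x); rewrite expRN => hi.
rewrite ger0_norm; last lra.
have e0 := expR_gt0 x.
have : (1 - x) * expR x <= 1.
  by rewrite -ler_pdivlMr // div1r.
nra.
Qed.

End RealBounds.

Section FrakB.
Variable R : realType.
Local Notation C := (CC R).
Implicit Types z w h : C.

Lemma expCD z w : expC (z + w) = expC z * expC w.
Proof.
apply: Cext; rewrite ?Re_mul ?Im_mul /expC /= Re_add Im_add expRD ?cosD ?sinD; ring.
Qed.

Lemma expC0 : expC (0 : C) = 1.
Proof. by apply: Cext; rewrite /expC /= expR0 ?cos0 ?sin0 mul1r. Qed.

Lemma qderiv_expC z : qderiv (@expC R) z (expC z).
Proof.
suff H0 : bigO 2 (fun h : C => expC h - 1 - h).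
  by apply: bigO_ext (bigOZ (expC z) H0) => h; rewrite expCD; ring.
(* A generous constant: the bounds [B1] and [B2] below add up to 13 |h|^2. *)
exists 20, 2^-1; split => // h hs.
have re := Re_le_cabs h; have im := Im_le_cabs h; have c0 := cabs_ge0 h.
set x := complex.Re h in re; set y := complex.Im h in im.
have x1 : `|x| <= 2^-1 by lra.
have y1 : `|y| <= 1 by lra.
have xx : x ^+ 2 <= cabs h ^+ 2.
  by rewrite -(real_normK (num_real x)) lerXn2r ?nnegrE.
have yy : y ^+ 2 <= cabs h ^+ 2.
  by rewrite -(real_normK (num_real y)) lerXn2r ?nnegrE.
have hh : cabs h ^+ 2 <= 1 by nra.
have := expR_sub_le x1; have := one_minus_cos_le y; have := sin_sub_id_le y1.
have := sqr_ge0 x; have := sqr_ge0 y.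
rewrite !ler_norml => y0 x0 /andP[s1 s2] /andP[k1 k2] /andP[e1 e2].
move: re im; rewrite !ler_norml => /andP[re1 re2] /andP[im1 im2].
apply: le_trans (cabs_le_ReIm _) _.
rewrite !(Re_add, Re_opp, Im_add, Im_opp) /expC /= -/x -/y.
set a := expR x - 1 - x in e1 e2; set b := 1 - cos y in k1 k2; set c := sin y - y in s1 s2.
have -> : expR x * cos y - 1 - x = a - b * (1 + x + a) by rewrite /a /b; ring.
have -> : expR x * sin y - 0 - y = c * (1 + x + a) + y * x + y * a by rewrite /a /c; ring.
have A : `|1 + x + a| <= 4 by rewrite ler_norml; apply/andP; split; lra.
have na : `|a| <= 2 * cabs h ^+ 2 by rewrite ler_norml; apply/andP; split; lra.
have nb : `|b| <= cabs h ^+ 2 by rewrite ler_norml; apply/andP; split; lra.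
have nc : `|c| <= cabs h ^+ 2 by rewrite ler_norml; apply/andP; split; lra.
have nx : `|x| <= cabs h by rewrite ler_norml; apply/andP; split; lra.
have ny : `|y| <= cabs h by rewrite ler_norml; apply/andP; split; lra.
have B1 : `|a - b * (1 + x + a)| <= 2 * cabs h ^+ 2 + cabs h ^+ 2 * 4.
  by apply: le_trans (ler_normB _ _) _; rewrite lerD // normrM ler_pM.
have B2 : `|c * (1 + x + a) + y * x + y * a| <=
    cabs h ^+ 2 * 4 + cabs h * cabs h + 1 * (2 * cabs h ^+ 2).
  apply: le_trans (ler_normD _ _) _; apply: lerD; last by rewrite normrM ler_pM.
  by apply: le_trans (ler_normD _ _) _; apply: lerD; rewrite normrM ler_pM.
have := sqr_ge0 (cabs h); move: B1 B2; rewrite expr2; lra.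
Qed.

Lemma psqrtC_sqr w : psqrtC w ^+ 2 = w.
Proof.
rewrite expr2 /psqrtC; case: w => a b /=.
set m := Num.sqrt (a ^+ 2 + b ^+ 2).
have m0 : 0 <= m by exact: sqrtr_ge0.
have mE : m ^+ 2 = a ^+ 2 + b ^+ 2 by rewrite sqr_sqrtr // addr_ge0 ?sqr_ge0.
have ma : `|a| <= m.
  rewrite -(ler_pXn2r (n := 2)) ?nnegrE // mE real_normK ?num_real //.
  by rewrite lerDl sqr_ge0.
move: ma; rewrite ler_norml => /andP[ma1 ma2].
have p0 : 0 <= (m + a) / 2 by lra.
have q0 : 0 <= (m - a) / 2 by lra.
have pq : Num.sqrt ((m + a) / 2) * Num.sqrt ((m - a) / 2) = `|b| / 2.
  rewrite -sqrtrM // -[RHS]ger0_norm; last by rewrite divr_ge0.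
  rewrite -[X in _ = X]sqrtr_sqr; congr Num.sqrt.
  rewrite [RHS]exprMn real_normK ?num_real //.
  have -> : b ^+ 2 = m ^+ 2 - a ^+ 2 by rewrite mE; ring.
  by field.
have s1 := sqr_sqrtr p0; have s2 := sqr_sqrtr q0; move: s1 s2 pq.
set s := Num.sqrt ((m + a) / 2); set t := Num.sqrt ((m - a) / 2) => s1 s2 pq.
apply: Cext; rewrite ?Re_mul ?Im_mul /=; case: ltP => b0.
- by lra.
- by lra.
- by rewrite (ltr0_norm b0) in pq; lra.
- by rewrite (ger0_norm b0) in pq; lra.
Qed.

Lemma Re_psqrtC_ge0 w : 0 <= complex.Re (psqrtC w).
Proof. exact: sqrtr_ge0. Qed.

(** A purely imaginary root s would make w = s^2 a nonpositive real; the hypothesis excludes exactly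
    this cut. *)
Lemma Re_psqrtC_gt0 w : (complex.Im w = 0 -> 0 < complex.Re w) ->
  0 < complex.Re (psqrtC w).
Proof.
move=> H; rewrite lt_neqAle Re_psqrtC_ge0 andbT eq_sym; apply/eqP => r0.
have := psqrtC_sqr w; rewrite expr2.
set s := psqrtC w in r0 * => e.
have i0 : complex.Im w = 0 by rewrite -e Im_mul r0 mul0r mulr0 addr0.
by have := H i0; rewrite -e Re_mul r0; have := sqr_ge0 (complex.Im s); lra.
Qed.

(** No case analysis on the branch: every value of the root has real part >= 0, so |sqrt(w+h) + s|
    >= Re s, and the product of sum and difference is h. The remainder is exactly -(sqrt(w+h) - s)^2
    / (2 s). *)
Lemma qderiv_psqrtC w : 0 < complex.Re (psqrtC w) ->
  qderiv (@psqrtC R) w (2 * psqrtC w)^-1.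
Proof.
set s := psqrtC w => s0.
have sne : s != 0 by apply: contraTneq s0 => ->; rewrite ltxx.
have fac h : (psqrtC (w + h) - s) * (psqrtC (w + h) + s) = h.
  by have := psqrtC_sqr (w + h); rewrite -subr_sqr /s !psqrtC_sqr => _; ring.
have lip : bigO 1 (fun h => psqrtC (w + h) - s).
  exists (complex.Re s)^-1, 1; split => //; first by rewrite invr_ge0 ltW.
  move=> h _; rewrite expr1 ler_pdivlMl // -{2}(fac h) cabsM mulrC.
  rewrite ler_wpM2l ?cabs_ge0 //.
  apply: le_trans (Re_le_cabs _); rewrite Re_add.
  by apply: le_trans (ler_norm _); rewrite lerDr Re_psqrtC_ge0.
apply: bigO_ext (bigOZ (- (2 * s)^-1) (bigOM lip lip)) => h.
by rewrite -{4}(fac h) -/s; field.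
Qed.

(** Since |2 Im z| < 2 <= pi, the sine vanishes only for real z, where the exponential is
    positive. *)
Lemma expC_not_neg z : inD z -> complex.Im (expC (2 * z)) = 0 ->
  0 < complex.Re (expC (2 * z)).
Proof.
move=> /inDE zD; rewrite /expC /=.
have -> : complex.Im (2 * z) = 2 * complex.Im z.
  by rewrite -toC_nat Im_mul Re_toC Im_toC; ring.
have im : `|complex.Im z| < 1 := le_lt_trans (Im_le_cabs z) zD.
have e0 := expR_gt0 (complex.Re (2 * z)); have pi2 := @pi_ge2 R.
move: im; rewrite ltr_norml => /andP[i1 i2].
have [|y0|->] := ltgtP (complex.Im z) 0; last by rewrite mulr0 cos0 mulr1.
  move=> y0 /eqP; rewrite mulf_eq0 (gt_eqF e0) /= => /eqP s.
  have : 0 < sin (- (2 * complex.Im z)) by apply: sin_gt0_pi; lra.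
  by rewrite sinN s oppr0 ltxx.
move=> /eqP; rewrite mulf_eq0 (gt_eqF e0) /= => /eqP s.
have : 0 < sin (2 * complex.Im z) by apply: sin_gt0_pi; lra.
by rewrite s ltxx.
Qed.

Lemma expC_add1_neq0 z : inD z -> expC (2 * z) + 1 != 0.
Proof.
move=> /expC_not_neg H; apply/eqP => e.
have E : expC (2 * z) = -1 by apply/eqP; rewrite -subr_eq0 opprK e.
by move: H; rewrite E /= oppr0 => /(_ erefl); rewrite oppr_gt0 ltr10.
Qed.

Lemma frakB_sqr z : inD z -> frakB z ^+ 2 = 2 * expC (2 * z) / (expC (2 * z) + 1).
Proof.
move=> zD; rewrite psqrtC_sqr /tanhC.
by have := expC_add1_neq0 zD => nz; field.
Qed.

Lemma Re_frakB_gt0 z : inD z -> 0 < complex.Re (frakB z).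
Proof.
move=> zD; apply: Re_psqrtC_gt0; rewrite -[1 + _]psqrtC_sqr -/(frakB z) frakB_sqr //.
have nz := expC_add1_neq0 zD; have P := expC_not_neg zD.
set q := _ / _; set E := expC _ in nz P q *.
(* If q = 1 + tanh z were real and <= 0, then 2 - q > 0 would make E = exp(2z) real and
   nonpositive. *)
have e : E * (2 - q) = q by rewrite /q; field.
move=> q0; rewrite ltNge; apply/negP => q1.
have qr : q = toC (complex.Re q) by apply: Cext.
have q2 : 0 < 2 - complex.Re q by lra.
have e' : E * toC (2 - complex.Re q) = toC (complex.Re q).
  by rewrite toCD toCN -qr toC_nat.
have := congr1 (@complex.Im R) e'; rewrite Im_mul Re_toC !Im_toC mulr0 add0r.
move/eqP; rewrite mulf_eq0 (gt_eqF q2) orbF => /eqP /P Ep.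
have := congr1 (@complex.Re R) e'; rewrite Re_mul !Re_toC Im_toC mulr0 subr0 => e2.
have : 0 < complex.Re E * (2 - complex.Re q) by rewrite mulr_gt0.
by rewrite e2 ltNge q1.
Qed.

Lemma frakB_neq0 z : inD z -> frakB z != 0.
Proof. by move=> /Re_frakB_gt0; apply: contraTneq => ->; rewrite ltxx. Qed.

Lemma frakB_sqr_neq2 z : inD z -> 2 - frakB z ^+ 2 != 0.
Proof.
move=> zD; have nz := expC_add1_neq0 zD; rewrite frakB_sqr //.
have -> : 2 - 2 * expC (2 * z) / (expC (2 * z) + 1) = 2 / (expC (2 * z) + 1) by field.
by rewrite mulf_neq0 ?invr_eq0 // pnatr_eq0.
Qed.

Lemma frakB0 : frakB (0 : C) = 1.
Proof.
have D0 : inD (0 : C) by apply/inDE; rewrite cabs0.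
have := frakB_sqr D0; rewrite mulr0 expC0 mulr1 divff ?pnatr_eq0 //.
move/eqP; rewrite -subr_eq0 -[X in _ - X](expr1n _ 2) subr_sqr mulf_eq0 => /orP[|/eqP e].
  by rewrite subr_eq0 => /eqP.
have := congr1 (@complex.Re R) e; have := Re_frakB_gt0 D0.
by rewrite Re_add /= => P0 P1; exfalso; clear e D0; lra.
Qed.

(** Differentiating B^2 = 1 + tanh gives 2 B B' = 1 - tanh^2 = B^2 (2 - B^2). Writing B' through B
    alone removes the exponential from the later equations. *)
Lemma qderiv_frakB z : inD z -> qderiv (@frakB R) z (frakB z * (2 - frakB z ^+ 2) / 2).
Proof.
move=> zD; have nz := expC_add1_neq0 zD; have B0 := frakB_neq0 zD.
pose E (y : C) := expC (2 * y).
have two : qderiv (fun y : C => 2 * y) z 2.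
  by have := qderivZ 2 (qderiv_id z); rewrite mulr1.
have dE : qderiv E z (E z * 2) := qderiv_comp (qderiv_expC (2 * z)) two.
have dE1 := qderivD dE (qderiv_cst 1 z).
have dE2 := qderivD dE (qderiv_cst (-1) z).
have dT := qderivD (qderiv_cst 1 z) (qderivM dE2 (@qderivV _ (fun y => E y + 1) z _ nz dE1)).
have := @qderiv_comp _ (@psqrtC R) (fun y => 1 + tanhC y) _ _ _
  (qderiv_psqrtC (Re_frakB_gt0 zD)) dT.
rewrite (_ : _ * _ = frakB z * (2 - frakB z ^+ 2) / 2) //.
have -> : psqrtC (1 + tanhC z) = frakB z by [].
rewrite mulrC; apply: (mulIf (mulf_neq0 (mulf_neq0 (_ : 2 != 0) B0) B0)).
  by rewrite pnatr_eq0.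
have -> : frakB z * (2 - frakB z ^+ 2) / 2 * (2 * frakB z * frakB z) =
   frakB z * ((2 - frakB z ^+ 2) * frakB z ^+ 2) by field.
rewrite frakB_sqr // -/(E z); move: nz; rewrite -/(E z) => nz.
by field; rewrite B0 nz.
Qed.

End FrakB.

(** * Maximum principle *)

Section MaximumPrinciple.
Variable R : realType.
Local Notation C := (CC R).
Implicit Types (F : C -> C) (u : C -> R) (z h : C).

Definition imag : C := (0 +i* 1)%C.

Definition epsdelta u z :=
  forall e : R, 0 < e -> exists2 d : R, 0 < d & forall h, cabs h < d -> `|u (z + h) - u z| < e.

Lemma cabs_imag h : cabs (imag * h) = cabs h.
Proof.
rewrite cabsM (_ : cabs imag = 1) ?mul1r //.
apply/eqP; rewrite -(@eqrXn2 _ 2) ?cabs_ge0 // expr1n cabs_sqr /= expr0n add0r expr1n.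
by [].
Qed.

Lemma epsdelta_ball u z (e : R) : epsdelta u z -> 0 < e ->
  exists2 d : R, 0 < d &
    forall x y : R, `|complex.Re z - x| < d -> `|complex.Im z - y| < d ->
      `|u (x +i* y)%C - u z| < e.
Proof.
move=> H /H[d d0 Hd]; exists (d / 2); first by rewrite divr_gt0.
move=> x y hx hy; pose h : C := ((x +i* y)%C : C) - z.
have -> : ((x +i* y)%C : C) = z + h by rewrite /h addrCA subrr addr0.
apply: Hd; apply: le_lt_trans (cabs_le_ReIm _) _.
rewrite /h Re_add Im_add Re_opp Im_opp /= distrC [X in _ + X]distrC; lra.
Qed.

Lemma disc_EVT u (r : R) : 0 <= r -> (forall z, cabs z <= r -> epsdelta u z) ->
  exists2 c, cabs c <= r & forall z, cabs z <= r -> u z <= u c.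
Proof.
move=> r0 Hu.
pose g (p : R * R) := u (p.1 +i* p.2)%C.
pose A := [set p : R * R | p.1 ^+ 2 + p.2 ^+ 2 <= r ^+ 2].
have AE (x y : R) : A (x, y) <-> cabs ((x +i* y)%C : C) <= r.
  have -> : (cabs ((x +i* y)%C : C) <= r) = (cabs ((x +i* y)%C : C) ^+ 2 <= r ^+ 2).
    by rewrite ler_pXn2r ?nnegrE ?cabs_ge0.
  by rewrite cabs_sqr.
have cA : compact A.
  apply: (@subclosed_compact _ _ (`[- r, r] `*` `[- r, r])).
  - apply: (@closed_comp _ _ (fun p : R * R => p.1 ^+ 2 + p.2 ^+ 2) [set x | x <= r ^+ 2]).
      move=> p _; apply: cvgD; apply: (@cvg_comp _ _ _ _ (fun x : R => x ^+ 2) _ (nbhs _)).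
      + exact: cvg_fst.
      + exact: exprn_continuous.
      + exact: cvg_snd.
      + exact: exprn_continuous.
    exact: closed_le.
  - by apply: compact_setX; exact: segment_compact.
  move=> [x y] /= /AE h; rewrite !in_itv /= -!ler_norml; split.
    exact: le_trans (Re_le_cabs ((x +i* y)%C : C)) h.
  exact: le_trans (Im_le_cabs ((x +i* y)%C : C)) h.
have cg : {within A, continuous g}.
  apply: continuous_in_subspaceT => -[x y]; rewrite inE => /AE /Hu hu.
  apply/cvgrPdist_lt => e e0; have [d d0 Hd] := epsdelta_ball hu e0.
  exists ([set x' | `|x - x'| < d], [set y' | `|y - y'| < d]).
    by split; apply/nbhs_ballP; exists d.
  by move=> [x' y'] [/= h1 h2]; rewrite distrC /g /=; apply: Hd.
have A0 : A !=set0 by exists (0, 0); rewrite /A /= expr0n addr0 sqr_ge0.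
have [[x y]] := compact_EVT_max A0 cA cg; rewrite inE => /AE xy H.
exists ((x +i* y)%C : C) => // -[x' y'] /AE h.
by apply: (H (x', y')); rewrite inE.
Qed.

Definition cross_sum u z (t : R) : R :=
  u (z + toC t) + u (z - toC t) + u (z + imag * toC t) + u (z - imag * toC t).

(** A discrete sub-mean-value property. The cubic error is what a second order expansion leaves, and
    it is negligible against the t^2 gained by adding a multiple of |z|^2. *)
Definition nearly_subharmonic u z := exists K d : R, [/\ 0 < d, 0 <= K &
  forall t : R, 0 < t -> t < d -> 4 * u z - K * t ^+ 3 <= cross_sum u z t].

Lemma nearly_subharmonic_sum (I : Type) (s : seq I) (u : I -> C -> R) z :
  (forall i, nearly_subharmonic (u i) z) ->
  nearly_subharmonic (fun y => \sum_(i <- s) u i y) z.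
Proof.
move=> H; elim: s => [|i s [K2 [d2 [d20 K20 H2]]]].
  exists 0, 1; split => // t _ _; rewrite /cross_sum !big_nil; lra.
have [K1 [d1 [d10 K10 H1]]] := H i.
exists (K1 + K2), (Num.min d1 d2); split; rewrite ?lt_min ?d10 ?addr_ge0 //.
move=> t t0; rewrite lt_min => /andP[td1 td2].
have := H1 _ t0 td1; have := H2 _ t0 td2; rewrite /cross_sum !big_cons mulrDl; lra.
Qed.

(* The cross terms of |a + b h + c h^2|^2 cancel over h = t, -t, it, -it. *)
Lemma cross_sum_quadratic (a b c : C) (t : R) :
  4 * cabs a ^+ 2 <= cross_sum (fun h => cabs (a + b * h + c * h ^+ 2) ^+ 2) 0 t.
Proof.
rewrite /cross_sum !add0r !cabs_sqr !expr2.
rewrite !(Re_add, Im_add, Re_mul, Im_mul, Re_opp, Im_opp) /=.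
move: (complex.Re a) (complex.Im a) (complex.Re b) (complex.Im b) (complex.Re c) (complex.Im c).
move=> a1 a2 b1 b2 c1 c2; rewrite -subr_ge0.
set X := (X in 0 <= X).
have -> : X = 4 * ((b1 * t) ^+ 2 + (b2 * t) ^+ 2 + (c1 * t ^+ 2) ^+ 2 + (c2 * t ^+ 2) ^+ 2).
  by rewrite /X; ring.
by rewrite mulr_ge0 // !addr_ge0 ?sqr_ge0.
Qed.

Lemma nearly_subharmonic_sqr F z P : peano 2 F z P ->
  nearly_subharmonic (fun y => cabs (F y) ^+ 2) z.
Proof.
move=> FP; set a := P`_0; set b := P`_1; set c := P`_2.
have : peano 2 F z (a%:P + b *: 'X + c *: 'X^2).
  apply: peano_coef_eq FP => i; rewrite !coefD coefC !coefZ coefX coefXn.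
  by case: i => [|[|[|//]]] _ /=; rewrite ?mulr0 ?mulr1 ?addr0 ?add0r.
move=> [K [d [d0 K0 H]]].
pose q (h : C) := a + b * h + c * h ^+ 2.
pose M := cabs a + cabs b + cabs c.
have M0 : 0 <= M by rewrite !addr_ge0 ?cabs_ge0.
(* Each of the four points loses at most 2 M K t^3, because |q| <= M for t <= 1 and |q|^2 - |F|^2 =
   (|q| - |F|)(|q| + |F|). *)
exists (8 * M * K), (Num.min d 1); split; rewrite ?lt_min ?d0 ?ltr01 ?mulr_ge0 //.
move=> t t0; rewrite lt_min => /andP[td t1].
have one h : cabs h = t ->
    cabs (q h) ^+ 2 - 2 * M * K * t ^+ 3 <= cabs (F (z + h)) ^+ 2.
  move=> ht; have := H h; rewrite ht => /(_ td).
  rewrite (_ : (_ + _).[h] = q h); last by rewrite /q !hornerE /=; ring.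
  move=> e.
  have qM : cabs (q h) <= M.
    rewrite /q /M; apply: le_trans (cabsD _ _) _; apply: lerD.
      apply: le_trans (cabsD _ _) _; rewrite lerD2l cabsM ht.
      by rewrite ler_piMr ?cabs_ge0 // ltW.
    rewrite cabsM cabsX ht ler_piMr ?cabs_ge0 //.
    by rewrite exprn_ile1 // ltW.
  have := cabs_dist (q h) (F (z + h)).
  rewrite -(cabsN (q h - _)) opprB => D.
  have q0 := cabs_ge0 (q h); have F0 := cabs_ge0 (F (z + h)).
  have kt : 0 <= K * t ^+ 3 by rewrite mulr_ge0 // exprn_ge0 // ltW.
  have {D e} e : cabs (q h) - cabs (F (z + h)) <= K * t ^+ 3 by apply: le_trans D e.
  rewrite -mulrA; move: e qM kt q0 F0.
  move: (K * t ^+ 3) (cabs (q h)) (cabs (F (z + h))) => k x y e qM kt q0 F0.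
  have [xy|yx] := leP x y.
    have := mulr_ge0 M0 kt; nra.
  have : 0 <= (k - (x - y)) * (x + y) by rewrite mulr_ge0 //; lra.
  have : 0 <= k * (2 * M - (x + y)) by rewrite mulr_ge0 //; lra.
  rewrite !expr2; lra.
have t_ : cabs (toC t) = t by rewrite cabs_toC gtr0_norm.
have Q := cross_sum_quadratic a b c t; rewrite /cross_sum !add0r in Q.
have := one _ t_; have := one (- toC t); have := one (imag * toC t).
have := one (- (imag * toC t)); rewrite !cabsN !cabs_imag t_.
rewrite /q in Q *; move=> /(_ erefl) h1 /(_ erefl) h2 /(_ erefl) h3 h4.
rewrite /cross_sum -(peano_at FP) -/a; lra.
Qed.

Lemma cross_sum_normsq z (t : R) :
  cross_sum (fun y => cabs y ^+ 2) z t = 4 * cabs z ^+ 2 + 4 * t ^+ 2.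
Proof.
rewrite /cross_sum !cabs_sqr !(Re_add, Im_add, Re_mul, Im_mul, Re_opp, Im_opp) /=; ring.
Qed.

Lemma epsdelta_normsq F z : bigO 1 (fun h => F (z + h) - F z) ->
  epsdelta (fun y => cabs (F y) ^+ 2) z.
Proof.
move=> L e e0; pose M := 2 * cabs (F z) + 1.
have F0 := cabs_ge0 (F z); have M0 : 0 < M by rewrite /M; lra.
have e1 : 0 < Num.min 1 (e / M) by rewrite lt_min ltr01 divr_gt0.
have [d d0 Hd] := bigO_small L e1; exists d => // h /Hd.
rewrite lt_min ltr_pdivlMr // => /andP[h1 h2].
have := cabs_dist (F (z + h)) (F z); have := cabs_dist (F z) (F (z + h)).
rewrite -(cabsN (F z - _)) opprB; move: h1 h2 F0 M0; rewrite /M.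
have := cabs_ge0 (F (z + h)).
move: (cabs (F (z + h) - F z)) (cabs (F (z + h))) (cabs (F z)) => x y b y0 h1 h2 b0 M0 k1 k2.
have : 0 <= x by lra.
by rewrite ltr_norml => x0; apply/andP; split; nra.
Qed.

Lemma epsdeltaD u v z : epsdelta u z -> epsdelta v z -> epsdelta (fun y => u y + v y) z.
Proof.
move=> Hu Hv e e0; have e2 : 0 < e / 2 by rewrite divr_gt0.
have [[d1 d10 H1] [d2 d20 H2]] := (Hu _ e2, Hv _ e2).
exists (Num.min d1 d2); first by rewrite lt_min d10.
move=> h; rewrite lt_min => /andP[/H1 a /H2 b].
have -> : u (z + h) + v (z + h) - (u z + v z) = (u (z + h) - u z) + (v (z + h) - v z) by ring.
by apply: le_lt_trans (ler_normD _ _) _; lra.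
Qed.

Lemma epsdelta_sum (I : Type) (s : seq I) (u : I -> C -> R) z :
  (forall i, epsdelta (u i) z) -> epsdelta (fun y => \sum_(i <- s) u i y) z.
Proof.
move=> H; elim: s => [|i s IH].
  by move=> e e0; exists 1 => // h _; rewrite !big_nil subrr normr0.
move=> e /(epsdeltaD (H i) IH) [d d0 Hd]; exists d => // h /Hd.
by rewrite !big_cons.
Qed.

(** The perturbation v = u + e |z|^2 would have an interior maximum c. There the four-point sum of v
    is at most 4 v(c) but at least 4 v(c) + 4 e t^2 - K t^3, which is impossible for t <= e / (K +
    1). *)
Lemma maximum_principle u (r M : R) : 0 < r ->
  (forall z, cabs z <= r -> epsdelta u z) ->
  (forall z, cabs z < r -> nearly_subharmonic u z) ->
  (forall z, cabs z = r -> u z <= M) ->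
  forall z, cabs z <= r -> u z <= M.
Proof.
move=> r0 Hc Hs Hb z1 z1r; rewrite leNgt; apply/negP => uM.
(* Half the excess, spread over r^2: on the boundary v stays below u(z1), so the maximum of v is
   interior. *)
pose e := (u z1 - M) / (2 * r ^+ 2).
have e0 : 0 < e by rewrite divr_gt0 ?subr_gt0 // mulr_gt0 // exprn_gt0.
have er : e * r ^+ 2 < u z1 - M.
  have -> : e * r ^+ 2 = (u z1 - M) / 2 by rewrite /e; field; rewrite gt_eqF.
  lra.
pose v (y : C) := u y + cabs (toC e * y) ^+ 2 / e.
have vE y : v y = u y + e * cabs y ^+ 2.
  rewrite /v cabsM cabs_toC gtr0_norm // exprMn; congr (_ + _); field.
  by rewrite gt_eqF.
have [c cr Hmax] : exists2 c, cabs c <= r & forall z, cabs z <= r -> v z <= v c.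
  apply: disc_EVT; first exact: ltW.
  move=> z zr eps eps0.
  have := epsdeltaD (Hc _ zr) (@epsdelta_normsq (fun y => toC (Num.sqrt e) * y) z _).
  have E y : v y = u y + cabs (toC (Num.sqrt e) * y) ^+ 2.
    by rewrite vE cabsM exprMn cabs_toC ger0_norm ?sqrtr_ge0 // sqr_sqrtr // ltW.
  move=> /(_ _ _ eps0)[|d d0 Hd]; last by exists d => // h /Hd; rewrite !E.
  by apply: bigO_ext (bigOZ (toC (Num.sqrt e)) (bigO_id R)) => h; ring.
have vM : M + e * r ^+ 2 < v c.
  apply: lt_le_trans (Hmax _ z1r); rewrite vE.
  have : 0 <= e * cabs z1 ^+ 2 by rewrite mulr_ge0 ?sqr_ge0 // ltW.
  lra.
have {}cr : cabs c < r.
  rewrite lt_neqAle cr andbT; apply/eqP => E.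
  by move: vM; rewrite vE E; have := Hb _ E; lra.
have [K [d [d0 K0 HK]]] := Hs _ cr.
have K1 : 0 < K + 1 by lra.
pose t := Num.min (d / 2) (Num.min ((r - cabs c) / 2) (e / (K + 1))).
have t0 : 0 < t.
  rewrite !lt_min (divr_gt0 d0) // (divr_gt0 e0) // andbT /=.
  by rewrite divr_gt0 // subr_gt0.
have td : t < d by rewrite /t gt_min; apply/orP; left; lra.
have tr : t <= r - cabs c.
  rewrite /t !ge_min; apply/orP; right; apply/orP; left; lra.
have tK : t * (K + 1) <= e.
  by rewrite -ler_pdivlMr // /t !ge_min lexx !orbT.
have t_ : cabs (toC t) = t by rewrite cabs_toC gtr0_norm.
have pt h : cabs h = t -> v (c + h) <= v c.
  by move=> ht; apply: Hmax; apply: le_trans (cabsD _ _) _; rewrite ht; lra.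
have cs : cross_sum v c t <= 4 * v c.
  have := pt _ t_; have := pt (- toC t); have := pt (imag * toC t).
  have := pt (- (imag * toC t)); rewrite !cabsN !cabs_imag t_ /cross_sum.
  by move=> /(_ erefl) h1 /(_ erefl) h2 /(_ erefl) h3 h4; lra.
have csE : cross_sum v c t = cross_sum u c t + e * cross_sum (fun y => cabs y ^+ 2) c t.
  by rewrite /cross_sum !vE; ring.
have := HK _ t0 td; move: cs; rewrite csE cross_sum_normsq vE => cs ks.
have : 4 * e * t ^+ 2 <= K * t * t ^+ 2 by move: cs ks; rewrite (exprS t 2); lra.
rewrite ler_pM2r ?exprn_gt0 // => h.
have : K * t <= t * (K + 1) by lra.
lra.
Qed.

(** Stated for a sum of squares because the l^2 inequality must control all coefficients at once,
    not one at a time. *)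
Lemma maximum_modulus_sum m (F : 'I_m -> C -> C) (r M : R) : 0 < r -> r < 1 ->
  (forall i z, inD z -> exists P, peano 2 (F i) z P) ->
  (forall z, cabs z = r -> \sum_i cabs (F i z) ^+ 2 <= M) ->
  forall z, cabs z <= r -> \sum_i cabs (F i z) ^+ 2 <= M.
Proof.
move=> r0 r1 HF; apply: maximum_principle => // z zr.
  have zD : inD z by apply/inDE/(le_lt_trans zr).
  apply: epsdelta_sum => i; apply: epsdelta_normsq.
  by have [P FP] := HF i z zD; exact: peano_lip FP.
have zD : inD z by apply/inDE/(lt_trans zr).
apply: nearly_subharmonic_sum => i.
by have [P FP] := HF i z zD; exact: nearly_subharmonic_sqr FP.
Qed.

End MaximumPrinciple.

(** * Averages over roots of unity and Taylor's theorem *)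

Section Fourier.
Variable R : realType.
Local Notation C := (CC R).
Implicit Types (F G : C -> C) (z h : C) (P Q : {poly C}).

Lemma primitive_root_ex n : (0 < n)%N -> exists zeta : C, n.-primitive_root zeta.
Proof.
move=> n0; pose p : {poly R[i]%C} := 'X^n - 1.
have [r Dp] := closed_field_poly_normal p.
rewrite (monicP _) ?monicXnsubC // scale1r in Dp.
have rn1 : all n.-unity_root r by apply/allP=> z; rewrite -root_prod_XsubC -Dp.
have sz : (n < (size r).+1)%N by rewrite -(size_prod_XsubC r id) -Dp size_XnsubC.
have [|z _ hz] := hasP (has_prim_root n0 rn1 _ sz); last by exists z.
by rewrite -separable_prod_XsubC -Dp separable_Xn_sub_1 // pnatr_eq0 -lt0n.
Qed.

Definition conjC z : C := (z^*)%C.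

Lemma conjC_add z w : conjC (z + w) = conjC z + conjC w.
Proof. exact: (rmorphD (@conjc R)). Qed.
Lemma conjC_mul z w : conjC (z * w) = conjC z * conjC w.
Proof. exact: (rmorphM (@conjc R)). Qed.
Lemma conjC_sum (I : Type) (r : seq I) (f : I -> C) :
  conjC (\sum_(i <- r) f i) = \sum_(i <- r) conjC (f i).
Proof.
elim: r => [|i r IH]; rewrite ?big_nil ?big_cons ?conjC_add ?IH //.
exact: (rmorph0 (@conjc R)).
Qed.
Lemma conjC_exp z n : conjC (z ^+ n) = conjC z ^+ n.
Proof. exact: (rmorphXn (@conjc R)). Qed.
Lemma mul_conjC z : z * conjC z = toC (cabs z ^+ 2).
Proof. by rewrite toCX -cabsE; exact/esym/sqr_normc. Qed.

Variables (N : nat) (zeta : C).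
Hypothesis prim : N.-primitive_root zeta.

Let N0 : (0 < N)%N := prim_order_gt0 prim.

Lemma primitive_root_cabs : cabs zeta = 1.
Proof.
apply/eqP; rewrite -(@pexpr_eq1 _ _ N) ?cabs_ge0 // -cabsX.
by rewrite (prim_expr_order prim) cabs1.
Qed.

Lemma primitive_root_neq0 : zeta != 0.
Proof. by rewrite -cabs_eq0 primitive_root_cabs oner_eq0. Qed.

Lemma primitive_root_conj : conjC zeta = zeta^-1.
Proof.
apply: (mulfI primitive_root_neq0); rewrite mul_conjC primitive_root_cabs expr1n.
by rewrite mulfV // primitive_root_neq0.
Qed.

Lemma primitive_root_orth (j l : 'I_N) :
  \sum_(k < N) (zeta^-1 ^+ j * zeta ^+ l) ^+ k = if j == l then N%:R else 0.
Proof.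
have z0 := primitive_root_neq0.
set w := _ * _; case: eqP => [jl|/eqP jl].
  have -> : w = 1 by rewrite /w jl -exprMn mulVf // expr1n.
  by rewrite (eq_bigr (fun=> 1)) ?sumr_const ?card_ord // => k _; rewrite expr1n.
have w1 : w != 1.
  apply: contra jl => /eqP e; rewrite -val_eqE /=.
  have : zeta ^+ l = zeta ^+ j.
    have zj : zeta ^+ j != 0 by rewrite expf_neq0.
    by apply: (mulfI (_ : (zeta ^+ j)^-1 != 0)); rewrite ?invr_eq0 // mulVf // -exprVn.
  move/eqP; rewrite (eq_prim_root_expr prim) !modn_small // => /eqP ->.
  by [].
have wN : w ^+ N = 1.
  rewrite /w exprMn -!exprM mulnC [(l * N)%N]mulnC !exprM exprVn.
  by rewrite (prim_expr_order prim) invr1 !expr1n mulr1.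
apply/eqP; have := subrX1 w N; rewrite wN subrr => /esym/eqP.
by rewrite mulf_eq0 subr_eq0 (negbTE w1).
Qed.

Definition dft (y : 'I_N -> C) (k : 'I_N) : C :=
  N%:R^-1 * \sum_(j < N) (zeta^-1 ^+ k) ^+ j * y j.

Lemma dft_parseval y :
  \sum_k cabs (dft y k) ^+ 2 = N%:R^-1 * \sum_j cabs (y j) ^+ 2.
Proof.
have NC : (N%:R : C) != 0 by rewrite pnatr_eq0 -lt0n.
apply: toC_inj; rewrite toCM toCV toC_nat.
have toC_sum (I : finType) (f : I -> R) : toC (\sum_i f i) = \sum_i toC (f i).
  by elim/big_ind2: _ => // x1 x2 y1 y2 <- <-; rewrite toCD.
rewrite !toC_sum.
have E k : toC (cabs (dft y k) ^+ 2) = N%:R^-1 ^+ 2 *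
    \sum_(j < N) \sum_(l < N) (zeta^-1 ^+ j * zeta ^+ l) ^+ k * (y j * conjC (y l)).
  rewrite -mul_conjC /dft conjC_mul conjC_sum.
  have -> : conjC (N%:R^-1) = N%:R^-1.
    by rewrite -toC_nat -toCV /conjC /toC conjc_real.
  rewrite mulrACA -expr2; congr (_ * _).
  rewrite mulr_suml; apply: eq_bigr => j _.
  rewrite mulr_sumr; apply: eq_bigr => l _.
  rewrite conjC_mul !conjC_exp.
  have -> : conjC zeta^-1 = zeta.
    by rewrite -primitive_root_conj /conjC conjcK.
  by rewrite exprMn -!exprM mulnC [(l * k)%N]mulnC; ring.
rewrite (eq_bigr _ (fun k _ => E k)) -mulr_sumr exchange_big /=.
rewrite expr2 -mulrA; congr (_ * _); rewrite mulr_sumr; apply: eq_bigr => j _.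
rewrite exchange_big /=.
under eq_bigr => l _ do rewrite -mulr_suml primitive_root_orth.
rewrite (bigD1 j) //= eqxx big1 ?addr0 => [|l lj]; last first.
  by rewrite eq_sym (negbTE lj) mul0r.
by rewrite mulrA mulVf // mul1r mul_conjC.
Qed.

(** The finite counterpart of the Fourier integral over a circle, kept as a function of z so that it
    can be divided by z^k and submitted to the maximum principle. *)
Definition rotation_dft F (k : 'I_N) z : C := dft (fun j => F (zeta ^+ j * z)) k.

Lemma coef_comp_scale (c : C) P i : (P \Po (c *: 'X))`_i = c ^+ i * P`_i.
Proof.
elim/poly_ind: P i => [|P a IH] i; first by rewrite comp_poly0 coef0 mulr0.
rewrite comp_polyD comp_polyC comp_polyM comp_polyX !coefD !coefC coefMX.
rewrite -scalerAr coefZ coefMX; case: i => [|i] /=.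
  by rewrite mulr0 expr0 mul1r.
by rewrite IH !addr0 exprS mulrA.
Qed.

(* The average keeps the coefficients of index k mod N; there is only one below N. *)
Lemma peano_rotation_dft F P n (k : 'I_N) : (n < N)%N -> peano n F 0 P ->
  peano n (rotation_dft F k) 0 (P`_k *: 'X^k).
Proof.
move=> nN FP; have NC : (N%:R : C) != 0 by rewrite pnatr_eq0 -lt0n.
have Fj j : peano n (fun z => F (zeta ^+ j * z)) 0 (P \Po (zeta ^+ j *: 'X)).
  by apply: peano_scale; rewrite mulr0.
have H : peano n (rotation_dft F k) 0 (N%:R^-1 *:
     \sum_(j < N) (zeta^-1 ^+ k) ^+ j *: (P \Po (zeta ^+ j *: 'X))).
  by apply: peanoZ; apply: peano_sum => j; apply: peanoZ; exact: Fj.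
apply: peano_coef_eq H => i iln; have iN := leq_ltn_trans iln nN.
rewrite !coefZ coefXn coef_sum.
have -> : \sum_(j < N) ((zeta^-1 ^+ k) ^+ j *: (P \Po (zeta ^+ j *: 'X)))`_i =
   (\sum_(j < N) (zeta^-1 ^+ k * zeta ^+ (Ordinal iN)) ^+ j) * P`_i.
  rewrite mulr_suml; apply: eq_bigr => j _.
  by rewrite coefZ coef_comp_scale /= exprMn -!exprM [(i * j)%N]mulnC; ring.
rewrite primitive_root_orth -val_eqE /= eq_sym; case: eqP => [->|_].
  by rewrite mulrA mulVf // mul1r mulr1.
by rewrite mul0r !mulr0.
Qed.

Lemma rotation_dft_horner P (k : 'I_N) z : (size P <= N)%N ->
  rotation_dft (horner P) k z = P`_k * z ^+ k.
Proof.
move=> sP; have NC : (N%:R : C) != 0 by rewrite pnatr_eq0 -lt0n.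
rewrite /rotation_dft /dft.
under eq_bigr => j _ do rewrite (horner_coef_wide _ sP) mulr_sumr.
rewrite exchange_big /=.
have E (i : 'I_N) : \sum_(j < N) (zeta^-1 ^+ k) ^+ j * (P`_i * (zeta ^+ j * z) ^+ i) =
    (if k == i then N%:R else 0) * (P`_i * z ^+ i).
  rewrite -primitive_root_orth mulr_suml; apply: eq_bigr => j _.
  by rewrite !exprMn -!exprM [(i * j)%N]mulnC; ring.
rewrite (eq_bigr _ (fun i _ => E i)) (bigD1 k) //= big1 ?addr0 => [|i ik].
  by rewrite eqxx mulKf.
by rewrite eq_sym (negbTE ik) mul0r.
Qed.

End Fourier.

(** * Removable singularities at 0 *)

Section Division.
Variable R : realType.
Local Notation C := (CC R).
Implicit Types (F G : C -> C) (z h : C) (P Q : {poly C}).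

(** The value at 0 has to be supplied, as division by zero returns 0; the intended [c] is the k-th
    coefficient of F. *)
Definition divX F k (c : C) z : C := if z == 0 then c else F z / z ^+ k.

Lemma peano_divX F k P : peano k.+2 F 0 P -> (forall i, (i < k)%N -> P`_i = 0) ->
  peano 2 (divX F k P`_k) 0 (drop_poly k P).
Proof.
move=> [K [d [d0 K0 H]]] Pk; exists K, d; split => // h hd; rewrite add0r /divX.
have PE : P = drop_poly k P * 'X^k.
  rewrite -{1}(poly_take_drop k P) [take_poly _ _](_ : _ = 0) ?add0r //.
  by apply/polyP => i; rewrite coef_take_poly coef0; case: ifP => // /Pk.
case: eqP => [->|/eqP h0].
  rewrite horner_coef0 coef_drop_poly add0n subrr cabs0 mulr_ge0 // exprn_ge0 //.
have := H h hd; rewrite add0r {1}PE hornerM hornerXn => b.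
have hk : h ^+ k != 0 by rewrite expf_neq0.
have -> : F h / h ^+ k - (drop_poly k P).[h] =
   (F h - (drop_poly k P).[h] * h ^+ k) / h ^+ k by field.
rewrite cabsM cabsV ler_pdivrMr ?cabs_gt0 // cabsX -mulrA -exprD addnC.
by rewrite addnS addn2.
Qed.

Lemma peano_divX_neq0 F k c z P : z != 0 -> peano 2 F z P ->
  exists Q, peano 2 (divX F k c) z Q.
Proof.
move=> z0 FP.
have zk : z ^+ k != 0 by rewrite expf_neq0.
have [Q HQ] := @peanoV R 2 (fun y => y ^+ k) z _ zk (peanoX k (peano_id 2 z)).
exists (P * Q); apply: peano_near (peanoM FP HQ).
exists (cabs z); first by rewrite cabs_gt0.
move=> h hz; rewrite /divX; case: eqP => // zh.
have : cabs z = cabs h by rewrite -cabsN -(addr0_eq zh).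
by move=> E; rewrite E ltxx in hz.
Qed.

Lemma peano_divX_disc F k P z : (forall y, inD y -> exists Q, peano 2 F y Q) ->
  peano k.+2 F 0 P -> (forall i, (i < k)%N -> P`_i = 0) ->
  inD z -> exists Q, peano 2 (divX F k P`_k) z Q.
Proof.
move=> HF FP Pk zD; have [->|z0] := eqVneq z 0.
  by exists (drop_poly k P); exact: peano_divX.
by have [Q FQ] := HF z zD; exact: peano_divX_neq0 FQ.
Qed.

End Division.

(** * The l^2 inequality for coefficients and Taylor's theorem *)

Section Bessel.
Variable R : realType.
Local Notation C := (CC R).
Implicit Types (F G : C -> C) (z h : C) (P Q : {poly C}).

Lemma inD_mul_unimodular z (c : C) : cabs c = 1 -> inD z -> inD (c * z).
Proof. by move=> c1 /inDE zD; apply/inDE; rewrite cabsM c1 mul1r. Qed.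

Lemma smooth_rotation_dft N (zeta : C) (k : 'I_N) F : N.-primitive_root zeta ->
  smooth F -> smooth (rotation_dft zeta F k).
Proof.
move=> prim sF z zD n.
have : forall j : 'I_N, exists P, peano n (fun y => F (zeta ^+ j * y)) z P.
  move=> j; have jD : inD (zeta ^+ j * z).
    by apply: inD_mul_unimodular; rewrite // cabsX (primitive_root_cabs prim) expr1n.
  by have [P FP] := sF _ jD n; eexists; exact: peano_scale FP.
move=> /choice[P HP].
eexists; apply: peanoZ; apply: peano_sum => j; apply: peanoZ; exact: HP.
Qed.

(** The k-th rotation average divided by z^k has value P_k at 0, while on |z| = r Parseval bounds
    the squares; the maximum principle compares the two. The common factor r^(2m) is crude but
    harmless as r tends to 1. [m < n] because a second order expansion must survive division by z^k
    for k < m. *)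
Lemma bessel_disc F P n m (zeta : C) (r A : R) : smooth F -> peano n F 0 P ->
  (m < n)%N -> n.+1.-primitive_root zeta -> 0 < r -> r < 1 ->
  (forall z, cabs z = r -> n.+1%:R^-1 * \sum_(j < n.+1) cabs (F (zeta ^+ j * z)) ^+ 2 <= A) ->
  (\sum_(k < m) cabs P`_k ^+ 2) * r ^+ (2 * m) <= A.
Proof.
move=> sF FP mn prim r0 r1 HA.
have mN : (m <= n.+1)%N by rewrite leqW // ltnW.
pose w (k : 'I_m) : 'I_n.+1 := widen_ord mN k.
pose H (k : 'I_m) := rotation_dft zeta F (w k).
pose G (k : 'I_m) := divX (H k) k P`_k.
have HG k z : inD z -> exists Q, peano 2 (G k) z Q.
  move=> zD; have := @peano_divX_disc R (H k) k (P`_k *: 'X^k) z.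
  rewrite coefZ coefXn eqxx mulr1; apply => //.
  - by move=> y yD; exact: (smooth_rotation_dft (w k) prim sF yD 2).
  - have kn : (k.+2 <= n)%N by apply: leq_trans mn; rewrite ltnS.
    exact: peano_le kn (peano_rotation_dft prim (w k) (ltnSn n) FP).
  - by move=> i ik; rewrite coefZ coefXn (ltn_eqF ik) mulr0.
have bd z : cabs z = r -> \sum_k cabs (G k z) ^+ 2 <= A / r ^+ (2 * m).
  move=> zr; have z0 : z != 0 by rewrite -cabs_gt0 zr.
  rewrite ler_pdivlMr ?exprn_gt0 //; apply: le_trans (HA z zr).
  rewrite -(dft_parseval prim) -/(rotation_dft _ _ _) mulr_suml.
  apply: le_trans (_ : \sum_(k < m) cabs (H k z) ^+ 2 <= _).
    apply: ler_sum => k _; rewrite /G /divX (negbTE z0) cabsM cabsV cabsX zr.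
    rewrite exprMn -mulrA ler_piMr ?exprn_ge0 ?cabs_ge0 //.
    rewrite mulnC exprM -exprMn exprn_ile1 //.
      by rewrite mulr_ge0 ?invr_ge0 ?exprn_ge0 // ltW.
    rewrite ler_pdivrMl ?exprn_gt0 // mulr1 ler_wiXn2l ?(ltW r0) ?(ltW r1) //.
    exact: ltnW.
  pose f (k : 'I_n.+1) := cabs (rotation_dft zeta F k z) ^+ 2.
  have wE k : w k = inord k by apply: val_inj; rewrite /= inordK // (leq_trans (ltn_ord k)).
  have -> : \sum_(k < m) cabs (H k z) ^+ 2 = \sum_(k < m) f (inord k).
    by apply: eq_bigr => k _; rewrite /H wE.
  rewrite (big_ord_widen n.+1 (fun k => f (inord k)) mN) big_mkcond /=.
  apply: ler_sum => k _; rewrite inord_val; case: ifP => // _.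
  by rewrite exprn_ge0 ?cabs_ge0.
have := maximum_modulus_sum r0 r1 HG bd (z := 0); rewrite cabs0 => /(_ (ltW r0)).
rewrite ler_pdivlMr ?exprn_gt0 //; apply: le_trans.
rewrite ler_wpM2r ?exprn_ge0 ?(ltW r0) //.
by apply: ler_sum => k _; rewrite /G /divX eqxx.
Qed.

Lemma bernoulli_lower (d : R) n : 0 <= d -> d <= 1 -> 1 - n%:R * d <= (1 - d) ^+ n.
Proof.
move=> d0 d1; elim: n => [|n IH]; first by rewrite mul0r subr0 expr0.
rewrite exprS -addn1 natrD; have : (0 : R) <= n%:R by [].
have : 0 <= 1 - d by lra.
move: IH; move: (n%:R : R) ((1 - d) ^+ n) => k x; nra.
Qed.

Lemma le_of_le_expr (X S : R) n : 0 <= X ->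
  (forall r, 0 < r -> r < 1 -> X * r ^+ n <= S) -> X <= S.
Proof.
move=> X0 H; apply/ler_addgt0Pr => e e0.
have D : 0 < X * n%:R + e + 1.
  by have : 0 <= X * n%:R by [exact: mulr_ge0]; lra.
pose d := Num.min (e / (X * n%:R + e + 1)) 2^-1.
have d0 : 0 < d by rewrite lt_min divr_gt0 // invr_gt0 ltr0n.
have d2 : d <= 2^-1 by rewrite /d ge_min lexx orbT.
have de : d * (X * n%:R + e + 1) <= e by rewrite -ler_pdivlMr // /d ge_min lexx.
have r0 : 0 < 1 - d by lra.
have r1 : 1 - d < 1 by lra.
have := H _ r0 r1; have := ler_wpM2l X0 (bernoulli_lower n (ltW d0) (le_trans d2 (_ : 2^-1 <= 1))).
have -> : 2^-1 <= 1 :> R by lra.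
move=> /(_ isT) a /(le_trans a); have : 0 <= d * e by rewrite mulr_ge0 // ltW.
lra.
Qed.

(** On |z| = r one has |F Q| <= |Q|, and Parseval evaluates the average of |Q|^2 exactly, since
    [size Q <= n.+1] prevents two coefficients from sharing a residue. Letting r tend to 1 removes
    the powers of r. *)
Lemma multiplier_contraction F P Q n m : smooth F -> (forall z, inD z -> cabs (F z) <= 1) ->
  peano n F 0 P -> (size Q <= n.+1)%N -> (m < n)%N ->
  \sum_(k < m) cabs (P * Q)`_k ^+ 2 <= \sum_(k < n.+1) cabs Q`_k ^+ 2.
Proof.
move=> sF F1 FP sQ mn.
apply: (@le_of_le_expr _ _ (2 * m)).
  by apply: sumr_ge0 => k _; rewrite exprn_ge0 ?cabs_ge0.
move=> r r0 r1; have [zeta prim] := primitive_root_ex R (ltn0Sn n).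
have FQ : peano n (fun y => F y * Q.[y]) 0 (P * Q).
  apply: peanoM FP _; apply: bigO_ext (bigO0 R _) => h.
  by rewrite add0r subrr.
apply: (bessel_disc (smoothM sF (smooth_horner Q)) FQ mn prim r0 r1) => z zr.
have zD : inD z by apply/inDE; rewrite zr.
apply: le_trans (_ : n.+1%:R^-1 * \sum_(j < n.+1) cabs Q.[zeta ^+ j * z] ^+ 2 <= _).
  rewrite ler_wpM2l ?invr_ge0 //; apply: ler_sum => j _.
  rewrite lerXn2r ?nnegrE ?cabs_ge0 // cabsM ler_piMl ?cabs_ge0 // F1 //.
  by apply: inD_mul_unimodular; rewrite // cabsX (primitive_root_cabs prim) expr1n.
rewrite -(dft_parseval prim); apply: ler_sum => k _.
have E := rotation_dft_horner prim k z sQ; rewrite /rotation_dft in E.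
rewrite E cabsM cabsX zr exprMn ler_piMr ?exprn_ge0 ?cabs_ge0 //.
by rewrite -exprM exprn_ile1 // ltW.
Qed.

Lemma peano_seq F z : (forall n, exists P, peano n F z P) ->
  exists d : nat -> C, forall n, peano n F z (\poly_(i < n.+1) d i).
Proof.
move=> /choice[P HP]; exists (fun n => (P n)`_n) => n.
apply: peano_coef_eq (HP n) => i iln; rewrite coef_poly ltnS iln.
exact: (peano_uniq (peano_le iln (HP n)) (HP i) (leqnn i)).
Qed.

(** The exponent k + 1 instead of k comes from the common factor in [bessel_disc]; it merely
    replaces M by M / r later on. *)
Lemma cauchy_estimate F (d : nat -> C) (r M : R) k : smooth F ->
  (forall n, peano n F 0 (\poly_(i < n.+1) d i)) -> 0 < r -> r < 1 -> 0 <= M ->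
  (forall z, cabs z = r -> cabs (F z) <= M) -> cabs (d k) * r ^+ k.+1 <= M.
Proof.
move=> sF Hd r0 r1 M0 HM.
have [zeta prim] := primitive_root_ex R (ltn0Sn k.+2).
have A z : cabs z = r ->
    k.+3%:R^-1 * \sum_(j < k.+3) cabs (F (zeta ^+ j * z)) ^+ 2 <= M ^+ 2.
  move=> zr; rewrite ler_pdivrMl ?ltr0n // mulr_natl -[X in _ *+ X]card_ord -sumr_const.
  apply: ler_sum => j _; rewrite lerXn2r ?nnegrE ?cabs_ge0 // HM //.
  by rewrite cabsM cabsX (primitive_root_cabs prim) expr1n mul1r.
have := bessel_disc sF (Hd k.+2) (ltnSn k.+1) prim r0 r1 A.
rewrite big_ord_recr /= coef_poly ltnS (leqW (leqnSn k)) => h.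
have S0 : 0 <= \sum_(i < k.+1) cabs (\poly_(j < k.+3) d j)`_i ^+ 2.
  by apply: sumr_ge0 => i _; rewrite exprn_ge0 ?cabs_ge0.
rewrite -(@ler_pXn2r _ 2) ?nnegrE ?mulr_ge0 ?cabs_ge0 ?exprn_ge0 ?(ltW r0) //.
apply: le_trans h; rewrite exprMn -exprM [(k.+1 * 2)%N]mulnC.
rewrite ler_wpM2r ?exprn_ge0 ?(ltW r0) // lerDr.
by apply: sumr_ge0 => i _; rewrite exprn_ge0 ?cabs_ge0.
Qed.

Lemma smooth_bounded F (r : R) : smooth F -> 0 <= r -> r < 1 ->
  exists2 M : R, 0 <= M & forall z, cabs z <= r -> cabs (F z) <= M.
Proof.
move=> sF r0 r1.
have [c cr Hc] : exists2 c, cabs c <= r &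
    forall z, cabs z <= r -> cabs (F z) ^+ 2 <= cabs (F c) ^+ 2.
  apply: disc_EVT => // z zr; apply: epsdelta_normsq.
  have zD : inD z by apply/inDE/(le_lt_trans zr).
  by have [P FP] := sF z zD 0%N; exact: peano_lip FP.
exists (cabs (F c)); first exact: cabs_ge0.
by move=> z /Hc; rewrite ler_pXn2r ?nnegrE ?cabs_ge0.
Qed.

(* n q^n <= L^2 / n for L = 1 / (1 - sqrt q). *)
Lemma natr_geometric_cvg0 (K q e : R) : 0 <= q -> q < 1 -> 0 <= K -> 0 < e ->
  exists N, forall n, (N <= n)%N -> K * n.+1%:R * q ^+ n < e.
Proof.
move=> q0 q1 K0 e0; pose s := Num.sqrt q.
have sE : s ^+ 2 = q by rewrite sqr_sqrtr.
have s0 : 0 <= s by exact: sqrtr_ge0.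
have s1 : s < 1 by rewrite ltNge; apply/negP => s1; nra.
pose L := (1 - s)^-1; have L0 : 0 < L by rewrite invr_gt0 subr_gt0.
pose X := 2 * K * L ^+ 2 / e + 1.
have X0 : 0 <= X by rewrite addr_ge0 // divr_ge0 ?mulr_ge0 ?exprn_ge0 // ltW.
exists (Num.bound X) => n Nn.
have nX : X < n%:R by apply: lt_le_trans (archi_boundP X0) _; rewrite ler_nat.
have n1 : 1 < n%:R :> R.
  apply: le_lt_trans nX; rewrite /X lerDr divr_ge0 ?mulr_ge0 ?exprn_ge0 // ltW //.
have n0 : 0 < n%:R :> R by lra.
have sn : 0 <= s ^+ n by rewrite exprn_ge0.
have a := natr_geometric_bound n s0 s1; rewrite -/L in a.
have b : (n%:R * s ^+ n) ^+ 2 <= L ^+ 2.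
  by rewrite lerXn2r ?nnegrE ?mulr_ge0 // ltW.
rewrite -sE -exprM mulnC exprM -addn1 natrD.
have : 2 * K * L ^+ 2 < e * n%:R.
  have : 2 * K * L ^+ 2 / e < n%:R by rewrite /X in nX; lra.
  by rewrite ltr_pdivrMr // [e * _]mulrC.
move=> c; rewrite -(ltr_pM2r n0); apply: le_lt_trans c.
apply: le_trans (_ : K * (2 * (n%:R * s ^+ n) ^+ 2) <= _); last first.
  by rewrite [2 * K]mulrC -mulrA ler_wpM2l // ler_wpM2l.
rewrite -!mulrA ler_wpM2l // exprMn.
move: (s ^+ n) sn => x sn; move: (n%:R : R) n1 n0 => k n1 n0.
have : 0 <= x ^+ 2 * k * (k - 1) by rewrite !mulr_ge0 ?subr_ge0 ?(ltW n0) ?(ltW n1).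
lra.
Qed.

(** On |y| = r, Cauchy's estimates bound F minus its n-th partial sum by (n + 1) M / r. This
    difference is divisible by y^n, so the maximum principle gives (n + 1) (M / r) (|z| / r)^n at z,
    which tends to 0. *)
Lemma taylor_expansion F : smooth F -> exists2 d : nat -> C, taylor_D F d &
  forall n, peano n F 0 (\poly_(i < n.+1) d i).
Proof.
move=> sF; have D0 : inD (0 : C) by apply/inDE; rewrite cabs0.
have [d Hd] := peano_seq (sF 0 D0); exists d => //; apply/taylorP => z zD e e0.
have F0 : F 0 = d 0%N by rewrite -(peano_at (Hd 0%N)) coef_poly.
have [->|z0] := eqVneq z 0.
  by exists 1%N => -[//|n] _; rewrite psum0 F0 subrr cabs0.
have z1 : cabs z < 1 by apply/inDE.
pose r := (1 + cabs z) / 2; have zp : 0 < cabs z by rewrite cabs_gt0.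
have r0 : 0 < r by rewrite /r; lra.
have r1 : r < 1 by rewrite /r; lra.
have zr : cabs z <= r by rewrite /r; lra.
have [M M0 HM] := smooth_bounded sF (ltW r0) r1.
have HMr y : cabs y = r -> cabs (F y) <= M by move=> yr; apply: HM; rewrite yr.
have ce k := cauchy_estimate k sF Hd r0 r1 M0 HMr.
have q0 : 0 <= cabs z / r by rewrite divr_ge0 // ltW.
have q1 : cabs z / r < 1 by rewrite ltr_pdivrMr // mul1r /r; lra.
have Mr : 0 <= M / r by rewrite divr_ge0 // ltW.
have [N HN] := natr_geometric_cvg0 q0 q1 Mr e0.
exists N => n /HN; apply: le_lt_trans.
pose T : {poly C} := \poly_(i < n) d i.
have TE y : T.[y] = psum d y n by rewrite horner_poly.
pose phi y := F y - T.[y].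
have sphi : smooth phi.
  apply: smooth_ext (smoothD sF (smooth_horner (- T))) => y _.
  by rewrite hornerN.
have phiP : peano n.+2 phi 0 (\poly_(i < n.+3) d i - T).
  apply: peanoB (Hd n.+2) _; apply: bigO_ext (bigO0 R _) => h.
  by rewrite add0r subrr.
set Q := _ - T in phiP.
have Q0 i : (i < n)%N -> Q`_i = 0.
  move=> iln; have i3 : (i < n.+3)%N by rewrite (ltn_trans iln) // ltnS leqW.
  by rewrite coefB !coef_poly iln i3 subrr.
pose G (_ : 'I_1) := divX phi n Q`_n.
have HG i y : inD y -> exists P, peano 2 (G i) y P.
  by move=> yD; apply: peano_divX_disc phiP Q0 yD => x xD; exact: sphi.
have B0 : 0 <= (M / r) * n.+1%:R / r ^+ n.
  by apply: divr_ge0; [exact: mulr_ge0 | rewrite exprn_ge0 ?(ltW r0)].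
have bd y : cabs y = r -> \sum_i cabs (G i y) ^+ 2 <= ((M / r) * n.+1%:R / r ^+ n) ^+ 2.
  move=> yr; have y0 : y != 0 by rewrite -cabs_gt0 yr.
  rewrite big_ord1 /G /divX (negbTE y0) lerXn2r ?nnegrE ?cabs_ge0 //.
  rewrite cabsM cabsV cabsX yr ler_wpM2r ?invr_ge0 ?exprn_ge0 ?(ltW r0) //.
  apply: le_trans (cabsB _ _) _; rewrite -addn1 natrD mulrDr mulr1 addrC.
  apply: lerD; last first.
    apply: le_trans (HMr _ yr) _; rewrite ler_peMr // invf_ge1 ?ltW //.
  rewrite TE /psum; apply: le_trans (cabs_sum _ _ _) _.
  rewrite -[n in n%:R]card_ord -[_%:R]mul1r mulr_natr mulrnAr mulr1 -sumr_const.
  apply: ler_sum => i _; rewrite cabsM cabsX yr ler_pdivlMr //.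
  by rewrite -mulrA -exprSr ce.
have := maximum_modulus_sum r0 r1 HG bd zr.
rewrite big_ord1 ler_pXn2r ?nnegrE ?cabs_ge0 //.
rewrite /G /divX (negbTE z0) cabsM cabsV cabsX ler_pdivrMr ?exprn_gt0 //.
rewrite -TE -cabsN opprB -/(phi z) => /le_trans; apply.
by clearbody r; rewrite exprMn exprVn mulrAC mulrA.
Qed.

End Bessel.

(** * Coefficients of Schwarz functions *)

Section Coefficients.
Variable R : realType.
Local Notation C := (CC R).
Implicit Types (f g w : C -> C) (z h : C) (P Q W A : {poly C}) (a : nat -> C).

Lemma inD0 : inD (0 : C).
Proof. by apply/inDE; rewrite cabs0. Qed.

(** A pointwise expansion says nothing about the expansion of the derivative; the detour through the
    power series does. *)
Lemma smooth_derivative g : smooth g ->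
  exists2 g', smooth g' & forall z, inD z -> qderiv g z (g' z).
Proof.
move=> /taylor_expansion[d /taylorP Hd _].
have [g' Hg'] := psconv_ex (subgeometric_dcoef (subgeometric_of_psconv Hd)).
exists g'; first exact: psconv_smooth Hg'.
exact: psconv_qderiv Hd Hg'.
Qed.

Lemma peano_deriv_coef n F G z P Q : inD z ->
  (forall y, inD y -> qderiv F y (G y)) -> peano n.+1 F z P -> peano n G z Q ->
  forall i, (i <= n)%N -> Q`_i = i.+1%:R * P`_i.+1.
Proof.
move=> zD H FP GQ i iln.
have FQ : peano n.+1 F z (primitive_poly (F z) Q).
  apply: peano_primitive GQ; have [e e0 He] := inD_near zD.
  by exists e => // h /He/H.
rewrite (peano_uniq FP FQ (_ : i.+1 <= n.+1)%N) // coef_primitive.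
by rewrite mulrC divfK // pnatr_eq0.
Qed.

(* w is only assumed differentiable; its quadratic remainder is inherited from
   those of g and frakB because frakB' does not vanish on the disc. *)
Lemma lift_qderiv g w (g' z : C) : (forall y, inD y -> inD (w y)) ->
  (forall y, inD y -> g y = frakB (w y)) -> inD z -> derivable w z (1 : C) ->
  qderiv g z g' -> qderiv w z (2 * g' / (g z * (2 - g z ^+ 2))).
Proof.
move=> wD gE zD dw dg.
have lip := derivable_lip dw.
have B := bigO_comp (qderiv_frakB (wD _ zD)) lip.
have [e e0 He] := inD_near zD.
have nz : g z != 0 by rewrite gE //; apply/frakB_neq0/wD.
have n2 : 2 - g z ^+ 2 != 0 by rewrite gE //; apply/frakB_sqr_neq2/wD.
have := bigOZ (2 / (g z * (2 - g z ^+ 2))) (bigOB dg B).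
apply: bigO_near; exists e => // h /He hD /=.
rewrite addrCA subrr addr0 -!gE //; field.
by rewrite nz n2.
Qed.

(** Solving for w' leaves only g and g', over a denominator without zeros because [w] stays in the
    disc. The identity is returned as well, since [lift_coef] compares coefficients in it. *)
Lemma lift_smooth g w : smooth g -> (forall y, inD y -> inD (w y)) ->
  (forall y, inD y -> g y = frakB (w y)) -> holo_D w ->
  exists2 G, smooth G & exists2 g', smooth g' &
    [/\ forall z, inD z -> qderiv g z (g' z), forall z, inD z -> qderiv w z (G z) &
     forall z, inD z -> G z * (g z * (2 - g z ^+ 2)) = 2 * g' z].
Proof.
move=> sg wD gE hw; have [g' sg' dg] := smooth_derivative sg.
have nz z : inD z -> g z * (2 - g z ^+ 2) != 0.
  move=> zD; rewrite gE //; apply: mulf_neq0; first exact/frakB_neq0/wD.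
  exact/frakB_sqr_neq2/wD.
exists (fun z => 2 * g' z / (g z * (2 - g z ^+ 2))).
  apply: smoothM; first by apply: smoothM sg'; exact: smooth_cst.
  apply: (smoothV nz); apply: (smoothM sg).
  apply: smooth_ext (smoothD (smooth_cst 2) (smoothM (smooth_cst (-1)) (smoothX 2 sg))) => z _.
  by rewrite mulN1r.
exists g' => //; split => // z zD; first exact: lift_qderiv (hw _ zD) (dg _ zD).
by rewrite divfK // nz.
Qed.

Lemma coefM_lt4 P Q :
  [/\ (P * Q)`_0 = P`_0 * Q`_0,
      (P * Q)`_1 = P`_0 * Q`_1 + P`_1 * Q`_0,
      (P * Q)`_2 = P`_0 * Q`_2 + P`_1 * Q`_1 + P`_2 * Q`_0 &
      (P * Q)`_3 = P`_0 * Q`_3 + P`_1 * Q`_2 + P`_2 * Q`_1 + P`_3 * Q`_0].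
Proof. by split; rewrite coefM !big_ord_recl big_ord0 /= addr0 ?addrA. Qed.

Lemma lift_coef g w A W : smooth g -> (forall y, inD y -> inD (w y)) ->
  (forall y, inD y -> g y = frakB (w y)) -> holo_D w -> g 0 = 1 ->
  peano 4 g 0 A -> peano 4 w 0 W ->
  [/\ A`_1 = W`_1 / 2, A`_2 = W`_2 / 2 - W`_1 ^+ 2 / 8,
      A`_3 = W`_3 / 2 - W`_1 * W`_2 / 4 - 5 / 48 * W`_1 ^+ 3 &
      A`_4 = W`_4 / 2 - (2 * W`_1 * W`_3 + W`_2 ^+ 2) / 8
        - 5 / 16 * W`_1 ^+ 2 * W`_2 + 17 / 384 * W`_1 ^+ 4].
Proof.
move=> sg wD gE hw g0 gA wW.
have [G sG [g' sg' [dg dw ode]]] := lift_smooth sg wD gE hw.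
have [[Q GQ] [A' gA']] := (sG 0 inD0 3%N, sg' 0 inD0 3%N).
have QE := peano_deriv_coef inD0 dw wW GQ.
have AE := peano_deriv_coef inD0 dg gA gA'.
have A0 : A`_0 = 1 by rewrite (peano_at gA).
have A3 : peano 3 g 0 A := peano_le (isT : (3 <= 4)%N) gA.
have L := peanoM GQ (peanoM A3 (peanoB (peano_cst 3 2 0) (peanoM A3 A3))).
have Rr : peano 3 (fun z => G z * (g z * (2 - g z * g z))) 0 (2 *: A').
  apply: peano_near (peanoZ 2 gA'); have [e e0 He] := inD_near inD0.
  by exists e => // h /He/ode <-; rewrite expr2.
have E := peano_uniq L Rr.
have [U0 U1 U2 U3] := coefM_lt4 A A; set U := A * A in U0 U1 U2 U3 E L.
have [V0 V1 V2 V3] := coefM_lt4 A ((2 : C)%:P - U); set V := A * (_ - U) in V0 V1 V2 V3 E L.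
have [T0 T1 T2 T3] := coefM_lt4 Q V.
have [[[q0 q1] q2] q3] := (QE 0%N isT, QE 1%N isT, QE 2%N isT, QE 3%N isT).
have [[[a0 a1] a2] a3] := (AE 0%N isT, AE 1%N isT, AE 2%N isT, AE 3%N isT).
have [[[e0 e1] e2] e3] := (E 0%N isT, E 1%N isT, E 2%N isT, E 3%N isT).
move: V0 V1 V2 V3; rewrite !coefB !coefC /= U0 U1 U2 U3 A0 => V0 V1 V2 V3.
move: e0 e1 e2 e3; rewrite !coefZ T0 T1 T2 T3 V0 V1 V2 V3 q0 q1 q2 q3 a0 a1 a2 a3.
move: (W`_1) (W`_2) (W`_3) (W`_4) (A`_1) (A`_2) (A`_3) (A`_4) => c1 c2 c3 c4 x1 x2 x3 x4.
clear => e0 e1 e2 e3.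
(* In the i-th equation the new unknown A_(i+1) occurs only on the right, as 2 (i + 1) A_(i+1);
   hence the pivots 2, 4, 6, 8. *)
have solve (k x y l r : C) : k != 0 -> l = r -> (x - y) * k = r - l -> x = y.
  move=> k0 -> /eqP; rewrite subrr mulf_eq0 (negbTE k0) orbF subr_eq0.
  by move/eqP.
have nz n : n.+1%:R != 0 :> C by rewrite pnatr_eq0.
have X1 : x1 = c1 / 2 by apply: (solve 2 _ _ _ _ (nz 1%N) e0); field.
subst x1.
have X2 : x2 = c2 / 2 - c1 ^+ 2 / 8 by apply: (solve 4 _ _ _ _ (nz 3%N) e1); field.
subst x2.
have X3 : x3 = c3 / 2 - c1 * c2 / 4 - 5 / 48 * c1 ^+ 3.
  by apply: (solve 6 _ _ _ _ (nz 5%N) e2); field.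
subst x3; split => //.
by apply: (solve 8 _ _ _ _ (nz 7%N) e3); field.
Qed.

Lemma gamma_formulas a (c1 c2 c3 c4 : C) :
  2 * a 2%N = c1 / 2 -> 3 * a 3%N = c2 / 2 - c1 ^+ 2 / 8 ->
  4 * a 4%N = c3 / 2 - c1 * c2 / 4 - 5 / 48 * c1 ^+ 3 ->
  5 * a 5%N = c4 / 2 - (2 * c1 * c3 + c2 ^+ 2) / 8
        - 5 / 16 * c1 ^+ 2 * c2 + 17 / 384 * c1 ^+ 4 ->
  [/\ gamma 1 a = c1 / 8,
      gamma 2 a = (c2 - 7 / 16 * c1 ^+ 2) / 12,
      gamma 3 a = (c3 - 5 / 6 * c1 * c2 - c1 ^+ 3 / 12) / 16 &
      gamma 4 a = (c4 - 13 / 16 * c1 * c3 - 7 / 18 * c2 ^+ 2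
        - 85 / 288 * c1 ^+ 2 * c2 + 503 / 4608 * c1 ^+ 4) / 20].
Proof.
have nz n : n.+1%:R != 0 :> C by rewrite pnatr_eq0.
move=> h2 h3 h4 h5.
have E2 : a 2%N = c1 / 4 by apply: (mulfI (nz 1%N)); rewrite h2; field.
have E3 : a 3%N = c2 / 6 - c1 ^+ 2 / 24 by apply: (mulfI (nz 2%N)); rewrite h3; field.
have E4 : a 4%N = c3 / 8 - c1 * c2 / 16 - 5 / 192 * c1 ^+ 3.
  by apply: (mulfI (nz 3%N)); rewrite h4; field.
have E5 : a 5%N = c4 / 10 - c1 * c3 / 20 - c2 ^+ 2 / 40 - c1 ^+ 2 * c2 / 16
    + 17 / 1920 * c1 ^+ 4.
  by apply: (mulfI (nz 4%N)); rewrite h5; field.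
by split; rewrite /= /gamma1 /gamma2 /gamma3 /gamma4 ?E2 ?E3 ?E4 ?E5; field.
Qed.

(** The order is 6 for coefficients up to index 4, because division by z^4 must leave a second order
    expansion. *)
Lemma multiplier_bound w W (p1 p2 p3 : C) : smooth w -> (forall z, inD z -> cabs (w z) <= 1) ->
  peano 6 w 0 W -> w 0 = 0 ->
  cabs W`_1 ^+ 2 + cabs (W`_2 + p1 * W`_1) ^+ 2 +
  cabs (W`_3 + p1 * W`_2 + p2 * W`_1) ^+ 2 +
  cabs (W`_4 + p1 * W`_3 + p2 * W`_2 + p3 * W`_1) ^+ 2 <=
  1 + cabs p1 ^+ 2 + cabs p2 ^+ 2 + cabs p3 ^+ 2.
Proof.
move=> sw w1 wW w0; have W0 : W`_0 = 0 by rewrite (peano_at wW).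
pose Q := Poly [:: 1; p1; p2; p3].
have sQ : (size Q <= 7)%N by apply: leq_trans (size_Poly _) _.
have := multiplier_contraction sw w1 wW sQ (isT : (5 < 6)%N).
rewrite !big_ord_recl !big_ord0 /= !coefM !big_ord_recl !big_ord0 /= !coef_Poly /= W0.
rewrite !(mul0r, mulr0, mulr1, addr0, add0r) cabs0 cabs1 expr0n expr1n /= !(add0r, addr0).
rewrite !addrA.
set L := (X in X <= _ -> _); set L' := (X in _ -> X <= _).
suff -> : L = L' by [].
rewrite /L /L' ![W`__ * _]mulrC; congr (_ + cabs _ ^+ 2 + cabs _ ^+ 2 + cabs _ ^+ 2); ring.
Qed.

Lemma cabs_sqr_lin (s t : R) (x y : C) : cabs (toC s * x + toC t * y) ^+ 2 =
  (s * complex.Re x + t * complex.Re y) ^+ 2 + (s * complex.Im x + t * complex.Im y) ^+ 2.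
Proof. by rewrite cabs_sqr !(Re_add, Im_add, Re_mul, Im_mul) /= !mul0r !subr0 !addr0. Qed.

Lemma cabs_le1_of_sqr z : cabs z ^+ 2 <= 1 -> cabs z <= 1.
Proof. by rewrite -[X in _ <= X](expr1n _ 2) ler_pXn2r ?nnegrE ?cabs_ge0. Qed.

Lemma toC_frac m n : toC (m%:R / n%:R : R) = m%:R / n%:R.
Proof. by rewrite toCM toCV !toC_nat. Qed.

Section SchwarzCoefficients.
Variables (w : C -> C) (W : {poly C}).
Hypotheses (sw : smooth w) (w1 : forall z, inD z -> cabs (w z) <= 1)
  (wW : peano 6 w 0 W) (w0 : w 0 = 0).

Let bound p1 p2 p3 := multiplier_bound p1 p2 p3 sw w1 wW w0.

Lemma schwarz_coef1 : cabs W`_1 <= 1.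
Proof.
apply: cabs_le1_of_sqr; have := bound 0 0 0.
rewrite !mul0r !addr0 !cabs0 expr0n /= !addr0.
have := sqr_ge0 (cabs W`_2); have := sqr_ge0 (cabs W`_3); have := sqr_ge0 (cabs W`_4); lra.
Qed.

Let cabs_sqr_sqr_le : cabs (W`_1 ^+ 2) ^+ 2 <= cabs W`_1 ^+ 2.
Proof.
rewrite cabsX [X in X <= _]expr2 ler_piMl ?exprn_ge0 ?cabs_ge0 //.
by rewrite exprn_ile1 ?cabs_ge0 // schwarz_coef1.
Qed.

Lemma schwarz_coef2 : cabs (W`_2 - 7 / 16 * W`_1 ^+ 2) <= 1.
Proof.
apply: cabs_le1_of_sqr; have := bound (- 7 / 16 * W`_1) 0 0.
have -> : W`_2 + - 7 / 16 * W`_1 * W`_1 = W`_2 - 7 / 16 * W`_1 ^+ 2 by ring.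
rewrite !mul0r !addr0 !cabs0 expr0n /= !addr0.
have -> : cabs (- 7 / 16 * W`_1) = 7 / 16 * cabs W`_1.
  by rewrite mulNr cabsM -mulNr mulNr cabsN cabsM cabsV !cabs_nat.
move: (cabs (W`_3 + _)) (cabs (W`_4 + _)) => u v.
have := sqr_ge0 (cabs W`_1); have := sqr_ge0 u; have := sqr_ge0 v.
rewrite exprMn; lra.
Qed.

Lemma schwarz_coef3 :
  cabs (W`_3 - 5 / 6 * W`_1 * W`_2 - W`_1 ^+ 3 / 12) <= 1.
Proof.
apply: cabs_le1_of_sqr.
(* c_1 c_2 arises both from p_1 c_2 and from p_2 c_1, so [x] is half of its coefficient -5/6; [y] is
   the coefficient of c_1^3. *)
pose x : R := - 5 / 12; pose y : R := - 1 / 12.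
set b0 := W`_1; set b1 := W`_2; set b2 := W`_3.
have := bound (toC x * b0) (toC x * b1 + toC y * b0 ^+ 2) 0.
rewrite -/b0 -/b1 -/b2.
have -> : b2 + toC x * b0 * b1 + (toC x * b1 + toC y * b0 ^+ 2) * b0 =
    b2 - 5 / 6 * b0 * b1 - b0 ^+ 3 / 12.
  by rewrite /x /y !(toCM, toCV, toCN, toC_nat); field.
have -> : b1 + toC x * b0 * b0 = toC 1 * b1 + toC x * b0 ^+ 2.
  by rewrite toC1; ring.
move: (cabs (W`_4 + _ + _ + _)) => v; have v0 := sqr_ge0 v.
rewrite cabs0 expr0n addr0 cabsM exprMn cabs_toC real_normK ?num_real //.
rewrite !cabs_sqr_lin.
have B1 : cabs (b0 ^+ 2) ^+ 2 <= cabs b0 ^+ 2 by exact: cabs_sqr_sqr_le.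
have q (s t : R) : (x * t + y * s) ^+ 2 <= (1 * t + x * s) ^+ 2 + (1 - x ^+ 2) * s ^+ 2.
  have := sqr_ge0 (t - 55 / 100 * s); have := sqr_ge0 s; have := sqr_ge0 t.
  rewrite /x /y; lra.
have := q (complex.Re (b0 ^+ 2)) (complex.Re b1).
have := q (complex.Im (b0 ^+ 2)) (complex.Im b1).
move: B1; rewrite (cabs_sqr (b0 ^+ 2)).
have x1 : 0 <= 1 - x ^+ 2 by rewrite /x; lra.
move=> /(ler_wpM2l x1); lra.
Qed.

(** With X = (w p)_3, the last multiplier coefficient is taken as p_3 = x X + e c_1^3: a contracted
    copy of X, paid for by |X|^2 itself, and a small correction in c_1^3 that fixes the coefficient
    of c_1^4. *)
Lemma schwarz_coef4 :
  cabs (W`_4 - 13 / 16 * W`_1 * W`_3 - 7 / 18 * W`_2 ^+ 2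
        - 85 / 288 * W`_1 ^+ 2 * W`_2 + 503 / 4608 * W`_1 ^+ 4) <= 1.
Proof.
apply: cabs_le1_of_sqr.
have expand (x y z v : R) (b0 b1 b2 b3 : C) :
    b3 + toC x * b0 * b2 + (toC y * b1 + toC z * b0 ^+ 2) * b1 +
    (toC x * (b2 + toC (x + y) * (b0 * b1) + toC z * b0 ^+ 3) + toC (v - x * z) * b0 ^+ 3) * b0
    = b3 + toC (x + x) * b0 * b2 + toC y * b1 ^+ 2 +
      toC (z + x * (x + y)) * b0 ^+ 2 * b1 + toC v * b0 ^+ 4.
  by rewrite !(toCD, toCM, toCN); ring.
(* x + x, y, z + x (x + y) and v are the coefficients of c_1 c_3, c_2^2, c_1^2 c_2 and
   c_1^4; splitting 13/16 evenly leaves room in the quadratic forms q and q'. *)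
pose x : R := - 13 / 32; pose y : R := - 7 / 18; pose z : R := - 633 / 1024.
pose v : R := 503 / 4608; pose e : R := v - x * z.
have eE : e = v - x * z by [].
have x1 : 0 <= 1 - x ^+ 2 by rewrite /x; lra.
(* The term s^2 / 40 is slack carried over to [q'], where |c_1^3| <= |c_1^2| lets it pay for the
   correction in p_3. 77/100 and 7/100 approximate the ratios t / s at which the two forms are
   smallest. *)
have q (s t : R) :
    (y * t + z * s) ^+ 2 + 1 / 40 * s ^+ 2 <= (1 * t + x * s) ^+ 2 + (1 - x ^+ 2) * s ^+ 2.
  have := sqr_ge0 (t - 77 / 100 * s); have := sqr_ge0 s; have := sqr_ge0 t.
  rewrite /x /y /z; lra.
have q' (s t : R) : (x * t + e * s) ^+ 2 <= t ^+ 2 + 1 / 40 * s ^+ 2.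
  have := sqr_ge0 (t - 7 / 100 * s); have := sqr_ge0 s; have := sqr_ge0 t.
  rewrite /e /v /x /z; lra.
have k1 : toC (x + x) = - (13 / 16).
  by rewrite -[RHS]/(- (13%:R / 16%:R)) -toC_frac -toCN; congr toC; rewrite /x; field.
have k2 : toC y = - (7 / 18).
  by rewrite -[RHS]/(- (7%:R / 18%:R)) -toC_frac -toCN; congr toC; rewrite /y; field.
have k3 : toC (z + x * (x + y)) = - (85 / 288).
  by rewrite -[RHS]/(- (85%:R / 288%:R)) -toC_frac -toCN; congr toC; rewrite /z /x /y; field.
have k4 : toC v = 503 / 4608 by rewrite /v toC_frac.
clearbody e; clearbody x y z v.
set b0 := W`_1; set b1 := W`_2; set b2 := W`_3; set b3 := W`_4.
set F := (X in cabs X ^+ 2 <= 1).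
pose X := b2 + toC (x + y) * (b0 * b1) + toC z * b0 ^+ 3.
have := bound (toC x * b0) (toC y * b1 + toC z * b0 ^+ 2) (toC x * X + toC e * b0 ^+ 3).
rewrite -/b0 -/b1 -/b2 -/b3.
have -> : b2 + toC x * b0 * b1 + (toC y * b1 + toC z * b0 ^+ 2) * b0 = X.
  by rewrite /X toCD; ring.
have -> : b3 + toC x * b0 * b2 + (toC y * b1 + toC z * b0 ^+ 2) * b1 +
    (toC x * X + toC e * b0 ^+ 3) * b0 = F.
  by rewrite /X eE expand k1 k2 k3 k4 !mulNr.
have -> : b1 + toC x * b0 * b0 = toC 1 * b1 + toC x * b0 ^+ 2.
  by rewrite toC1; ring.
clearbody F X.
rewrite (cabsM (toC x) b0) exprMn cabs_toC real_normK ?num_real //.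
rewrite !cabs_sqr_lin (cabs_sqr X).
have B1 : cabs (b0 ^+ 2) ^+ 2 <= cabs b0 ^+ 2 by exact: cabs_sqr_sqr_le.
have D1 : cabs (b0 ^+ 3) ^+ 2 <= cabs (b0 ^+ 2) ^+ 2.
  rewrite lerXn2r ?nnegrE ?cabs_ge0 // exprS cabsM ler_piMl ?cabs_ge0 //.
  exact: schwarz_coef1.
have := ler_wpM2l x1 B1; rewrite {B1} (cabs_sqr (b0 ^+ 2)).
move: D1; rewrite (cabs_sqr (b0 ^+ 2)) (cabs_sqr (b0 ^+ 3)).
have := q (complex.Re (b0 ^+ 2)) (complex.Re b1).
have := q (complex.Im (b0 ^+ 2)) (complex.Im b1).
have := q' (complex.Re (b0 ^+ 3)) (complex.Re X).
have := q' (complex.Im (b0 ^+ 3)) (complex.Im X).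
move: (cabs F ^+ 2) (cabs b0 ^+ 2) (complex.Re X) (complex.Im X)
  (complex.Re b1) (complex.Im b1) (complex.Re (b0 ^+ 2)) (complex.Im (b0 ^+ 2))
  (complex.Re (b0 ^+ 3)) (complex.Im (b0 ^+ 3)) => f c X1 X2 t1 t2 s1 s2 d1 d2.
clear; lra.
Qed.

End SchwarzCoefficients.

End Coefficients.

(** * The class BT *)

Section BoundedTurning.
Variable R : realType.
Local Notation C := (CC R).
Implicit Types (f g w : C -> C) (z h : C) (P Q W A : {poly C}) (a : nat -> C).

Lemma qderiv_derive1 f z d : qderiv f z d -> derive1 f z = d.
Proof. by move=> /qderiv_is_derive H; rewrite derive1E; exact: derive_val. Qed.

Lemma taylor_derive1 f a : taylor_D f a -> exists2 g,
  forall z, inD z -> qderiv f z (g z) & forall z, inD z -> psconv (dcoef a) z (g z).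
Proof.
move=> /taylorP Hf.
have [g Hg] := psconv_ex (subgeometric_dcoef (subgeometric_of_psconv Hf)).
by exists g => //; exact: psconv_qderiv Hf Hg.
Qed.

(** [W] is left free to serve twice: an unknown expansion for the bounds, and the explicit ['X^n]
    for the extremal function. *)
Lemma gamma_schwarz f a w : taylor_D f a -> a 1%N = 1 -> holo_D w ->
  (forall z, inD z -> inD (w z)) -> w 0 = 0 ->
  (forall z, inD z -> derive1 f z = frakB (w z)) ->
  smooth w /\ forall W, peano 4 w 0 W ->
  [/\ gamma 1 a = W`_1 / 8,
      gamma 2 a = (W`_2 - 7 / 16 * W`_1 ^+ 2) / 12,
      gamma 3 a = (W`_3 - 5 / 6 * W`_1 * W`_2 - W`_1 ^+ 3 / 12) / 16 &
      gamma 4 a = (W`_4 - 13 / 16 * W`_1 * W`_3 - 7 / 18 * W`_2 ^+ 2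
        - 85 / 288 * W`_1 ^+ 2 * W`_2 + 503 / 4608 * W`_1 ^+ 4) / 20].
Proof.
move=> tf a1 hw wD w0 fB; have [g dg pg] := taylor_derive1 tf.
have gB z : inD z -> g z = frakB (w z).
  by move=> zD; rewrite -fB // (qderiv_derive1 (dg _ zD)).
have sg := psconv_smooth pg.
have g0 : g 0 = 1 by rewrite gB ?w0 ?frakB0 //; exact: inD0.
split=> [|W wW].
  have [G sG [g' _ [_ dw _]]] := lift_smooth sg wD gB hw.
  exact: smooth_primitive dw sG.
have [A gA AE] := psconv_peano 4 pg (inD0 R).
have [r1 r2 r3 r4] := lift_coef sg wD gB hw g0 gA wW.
apply: gamma_formulas.
- by rewrite -r1 AE.
- by rewrite -r2 AE.
- by rewrite -r3 AE.
- by rewrite -r4 AE.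
Qed.

(** Bootstrapping: an expansion of f of order n yields one of its derivative g, whose primitive
    expands f to order n + 1. *)
Lemma smooth_ode f g : (forall z, inD z -> qderiv f z (g z)) ->
  (forall n z, inD z -> (exists P, peano n f z P) -> exists P, peano n g z P) ->
  smooth f.
Proof.
move=> fg H z zD n; elim: n => [|n IH].
  exists (f z)%:P; apply: bigO_ext (qderiv_lip (fg _ zD)) => h.
  by rewrite hornerC.
have [Q gQ] := H n z zD IH; exists (primitive_poly (f z) Q).
apply: peano_primitive gQ; have [e e0 He] := inD_near zD.
by exists e => // h /He/fg.
Qed.

Lemma inD_exp z n : (0 < n)%N -> inD z -> inD (z ^+ n).
Proof.
move=> n0 /inDE zD; apply/inDE; rewrite cabsX.
by rewrite exprn_ilt1 ?cabs_ge0 // -lt0n.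
Qed.

(* F = frakB (z ^ n) solves F' = n z^(n-1) F (2 - F^2) / 2. *)
Lemma smooth_frakB_exp n : (0 < n)%N -> smooth (fun z : C => frakB (z ^+ n)).
Proof.
move=> n0.
pose G (z : C) := frakB (z ^+ n) * (2 - frakB (z ^+ n) ^+ 2) / 2 * (n%:R * z ^+ n.-1).
apply: (@smooth_ode _ G) => [z zD|m z zD [P BP]].
  have dX : qderiv (fun y : C => y ^+ n) z (n%:R * z ^+ n.-1).
    by rewrite -[_ * _]mulr1; exact: (qderivX n (qderiv_id z)).
  exact: (@qderiv_comp _ (@frakB R) (fun y => y ^+ n) z _ _ (qderiv_frakB (inD_exp n0 zD)) dX).
eexists; apply: peanoM.
  apply: peanoM (peano_cst _ _ _); apply: (peanoM BP).
  by apply: peanoB (peano_cst _ _ _) _; exact: peanoX BP.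
by apply: peanoM (peano_cst _ _ _) _; apply: peanoX; exact: peano_id.
Qed.

(** The integral f_n is realised by termwise integration of the Taylor series of B(z^n); the zero
    constant term of [icoef] gives f(0) = 0, and z^n itself is the subordinating function. *)
Lemma extremal_classBT n : (0 < n)%N -> exists (f : C -> C) (a : nat -> C),
  classBT f a /\ forall z, inD z -> derive1 f z = frakB (z ^+ n).
Proof.
move=> n0; pose g (z : C) := frakB (z ^+ n).
have [d /taylorP gd _] := taylor_expansion (smooth_frakB_exp n0).
have sd := subgeometric_of_psconv gd.
have [f fa] := psconv_ex (subgeometric_icoef sd).
have dE : dcoef (icoef d) = d.
  by apply/funext => k; rewrite /dcoef /= mulrC divfK // pnatr_eq0.
have df z : inD z -> qderiv f z (g z).
  by apply: (psconv_qderiv fa) => y yD; rewrite dE; exact: gd.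
have d1 z : inD z -> derive1 f z = g z by move=> /df/qderiv_derive1.
exists f, (icoef d); split => //; split.
  split; first by move=> z /df/qderiv_is_derive[].
  split; first exact/taylorP.
  split => //; split.
    have := psconv0 (gd 0 (inD0 R)); rewrite /= /g expr0n (gtn_eqF n0) frakB0 => <-.
    by rewrite divr1.
  apply: noshiro_warschawski df _ => z zD.
  exact/Re_frakB_gt0/inD_exp.
exists (fun z => z ^+ n); split; last split; last split => //.
- move=> z _; have /qderiv_is_derive[] // := qderivX n (qderiv_id z).
- by move=> z; exact: inD_exp.
by rewrite expr0n (gtn_eqF n0).
Qed.

Lemma cabs_div_nat z n (m : nat) : cabs z <= 1 -> (n = m)%N ->
  `|z / n%:R| <= (m%:R)^-1 :> C.
Proof.
move=> z1 ->; rewrite cabsE cabsM cabsV cabs_nat -toC_nat -toCV toC_le.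
by rewrite ler_piMl // invr_ge0.
Qed.

End BoundedTurning.

Unset Implicit Arguments.

Theorem theorem3p1 (R : realType) (n : nat) (hn : (1 <= n <= 4)%N) :
  (forall (f : CC R -> CC R) (a : nat -> CC R),
     classBT f a -> `|gamma n a| <= ((4 * (n + 1))%:R)^-1) /\
  (exists (f : CC R -> CC R) (a : nat -> CC R),
     classBT f a /\
     (forall z : CC R, inD z -> derive1 f z = frakB (z ^+ n)) /\
     `|gamma n a| = ((4 * (n + 1))%:R)^-1).
Proof.
split=> [f a [[hf [tf [a0 [a1 _]]]] [w [hw [wD [w0 fB]]]]]|].
  have [sw H] := gamma_schwarz tf a1 hw wD w0 fB.
  have [W wW] := sw 0 (inD0 R) 6%N.
  have w1 z : inD z -> cabs (w z) <= 1 by move=> /wD/inDE/ltW.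
  have [g1 g2 g3 g4] := H W (peano_le (isT : (4 <= 6)%N) wW).
  case: n hn => [|[|[|[|[|n]]]]] // _; rewrite ?g1 ?g2 ?g3 ?g4.
  - exact: (cabs_div_nat (schwarz_coef1 sw w1 wW w0)).
  - exact: (cabs_div_nat (schwarz_coef2 sw w1 wW w0)).
  - exact: (cabs_div_nat (schwarz_coef3 sw w1 wW w0)).
  - exact: (cabs_div_nat (schwarz_coef4 sw w1 wW w0)).
have n0 : (0 < n)%N by case/andP: hn.
have [f [a [fBT df]]] := extremal_classBT R n0; exists f, a; split => //; split => //.
have [[hf [tf [a0 [a1 _]]]] _] := fBT.
have hX : holo_D (fun z : CC R => z ^+ n).
  by move=> z _; have /qderiv_is_derive[] := qderivX n (qderiv_id z).
have XD z : inD z -> inD (z ^+ n : CC R) by exact: inD_exp.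
have X0 : (0 : CC R) ^+ n = 0 by rewrite expr0n (gtn_eqF n0).
have [_ /(_ 'X^n)] := gamma_schwarz tf a1 hX XD X0 df.
(* Here c_n = 1 and the other c_i vanish, so only the leading term c_n of the formula for gamma_n
   survives and equality holds. *)
have pX : peano 4 (fun z : CC R => z ^+ n) 0 'X^n.
  by apply: bigO_ext (bigO0 R _) => h; rewrite add0r hornerXn subrr.
move=> /(_ pX); rewrite !coefXn.
case: n hn {n0 fBT df hX XD X0 pX} => [|[|[|[|[|n]]]]] //= _ [g1 g2 g3 g4];
  rewrite ?g1 ?g2 ?g3 ?g4 !(mulr0n, mulr1n, expr0n, mulr0, mul0r, subr0, addr0) /=
    ?(mul0r, subr0, addr0, mulr0) mul1r normfV normr_nat //.
Qed.
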